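(* Let $\{\alpha,S_0,\vartheta_1,\vartheta_2\}$ be an admissible quadruple such that the pair $\{\alpha,\vartheta_1\}$ is controllable, and let $v$ be the pseudo-exponential potential generated by it. Then, for any $\varepsilon>0$, there is $\delta>0$ such that each pseudo-exponential potential $\widetilde v$ generated by an admissible quadruple $\{\widetilde\alpha,\widetilde S_0,\widetilde\vartheta_1,\widetilde\vartheta_2\}$ (with the same $n,m_1,m_2$) satisfying $$\|\alpha-\widetilde\alpha\|+\|S_0-\widetilde S_0\|+\|\vartheta_1-\widetilde\vartheta_1\|+\|\vartheta_2-\widetilde\vartheta_2\|<\delta$$ belongs to the $\varepsilon$-neighborhood of $v$, that is, $$\sup_{x\in[0,\infty)}\|v(x)-\widetilde v(x)\|<\varepsilon.$$
   Context: $\|\cdot\|$ is the $\ell^2$-induced matrix norm; $X>0$ means that $X$ is Hermitian with all eigenvalues positive. Let $n,m_1,m_2\in\mathbb{N}$, $j=\mathrm{diag}\{I_{m_1},-I_{m_2}\}$. A quadruple $\{\alpha,S_0,\vartheta_1,\vartheta_2\}$ of $n\times n$ matrices $\alpha,S_0$ and $n\times m_k$ matrices $\vartheta_k$ ($k=1,2$) is admissible if $S_0>0$ and $$\alpha S_0-S_0\alpha^*=\mathrm{i}(\vartheta_1\vartheta_1^*+\vartheta_2\vartheta_2^* ).$$ The pair $\{\alpha,\vartheta_1\}$ is controllable if $\mathrm{span}\bigcup_{k=0}^{n-1}\mathrm{Im}(\alpha^k\vartheta_1)=\mathbb{C}^n$. The pseudo-exponential potential generated by an admissible quadruple is the $m_1\times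 m_2$ matrix function on $[0,\infty)$ $$v(x)=2\vartheta_1^*\mathrm{e}^{\mathrm{i}x\alpha^*}S(x)^{-1}\mathrm{e}^{\mathrm{i}x\alpha}\vartheta_2,$$ where $$S(x)=S_0+\int_0^x\Lambda(t)j\Lambda(t)^*\,dt,\qquad \Lambda(x)=\begin{bmatrix}\mathrm{e}^{-\mathrm{i}x\alpha}\vartheta_1 & \mathrm{e}^{\mathrm{i}x\alpha}\vartheta_2\end{bmatrix}.$$ *)

(* Defs.v *)
From mathcomp Require Export all_boot all_order all_algebra.
From mathcomp Require Export spectral sesquilinear complex.
From mathcomp Require Export all_classical all_reals all_analysis.

Set Implicit Arguments.
Unset Strict Implicit.
Unset Printing Implicit Defensive.

Import Order.TTheory GRing.Theory Num.Theory.
Import numFieldNormedType.Exports.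

Local Open Scope classical_set_scope.
Local Open Scope complex_scope.
Local Open Scope sesquilinear_scope.
Local Open Scope ring_scope.

Definition l2norm (R : realType) (n : nat) (u : 'cV[R[i]]_n) : R :=
  Num.sqrt (\sum_(k < n) (Normc.normc (u k 0)) ^+ 2).

(* The unit ball, rather than the unit sphere, is used so that the set of
   values is nonempty also when there are no columns. *)
Definition opnorm (R : realType) (m n : nat) (A : 'M[R[i]]_(m, n)) : R :=
  sup [set l2norm (A *m u) | u in [set u : 'cV[R[i]]_n | l2norm u <= 1]].

(* [eigenvalue] is about row vectors; the set of eigenvalues is the same as for
   column vectors.  In R[i], [0 < a] means that a is real and positive. *)
Definition posdefmx (R : realType) (n : nat) (X : 'M[R[i]]_n) : Prop :=
  X \is hermsymmx /\ (forall a : R[i], eigenvalue X a -> 0 < a).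

(* R[i]^o is R[i] with the topology given by its modulus; the limit is taken in
   the entrywise topology on matrices. *)
Definition expmx (R : realType) (n : nat) (A : 'M[R[i]]_n) : 'M[R[i]]_n :=
  limn (series (fun k : nat => (k`!%:R^-1 *: A ^+ k) : 'M[R[i]^o]_n)).

Definition mxintegral (R : realType) (m n : nat) (a b : R)
    (F : R -> 'M[R[i]]_(m, n)) : 'M[R[i]]_(m, n) :=
  \matrix_(k, l)
    ((\int[lebesgue_measure]_(t in `[a, b]) complex.Re (F t k l)) +i*
     (\int[lebesgue_measure]_(t in `[a, b]) complex.Im (F t k l))).

Definition admissible (R : realType) (n m1 m2 : nat) (alpha S0 : 'M[R[i]]_n)
    (theta1 : 'M[R[i]]_(n, m1)) (theta2 : 'M[R[i]]_(n, m2)) : Prop :=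
  posdefmx S0 /\
  alpha *m S0 - S0 *m alpha^t* =
    'i%C *: (theta1 *m theta1^t* + theta2 *m theta2^t*).

(* Matrix row spaces stand for subspaces in MathComp: Im M is the row space of
   M^T, and the sum of subspaces is the span of their union. *)
Definition controllable (R : realType) (n m : nat) (alpha : 'M[R[i]]_n)
    (theta : 'M[R[i]]_(n, m)) : Prop :=
  row_full (\sum_(k < n) <<(alpha ^+ k *m theta)^T>>)%MS.

Definition jmx (R : realType) (m1 m2 : nat) : 'M[R[i]]_(m1 + m2) :=
  block_mx 1%:M 0 0 (- 1%:M).

Definition Lambda (R : realType) (n m1 m2 : nat) (alpha : 'M[R[i]]_n)
    (theta1 : 'M[R[i]]_(n, m1)) (theta2 : 'M[R[i]]_(n, m2)) (x : R) :
    'M[R[i]]_(n, m1 + m2) :=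
  row_mx (expmx (- ('i%C * x%:C) *: alpha) *m theta1)
         (expmx (('i%C * x%:C) *: alpha) *m theta2).

Definition Smx (R : realType) (n m1 m2 : nat) (alpha S0 : 'M[R[i]]_n)
    (theta1 : 'M[R[i]]_(n, m1)) (theta2 : 'M[R[i]]_(n, m2)) (x : R) :
    'M[R[i]]_n :=
  S0 + mxintegral 0 x (fun t =>
         Lambda alpha theta1 theta2 t *m jmx R m1 m2 *m
         (Lambda alpha theta1 theta2 t)^t*).

(* Meant for 0 <= x and an admissible quadruple: S(x) is then positive
   definite, so [invmx] is a genuine inverse. *)
Definition pseudo_exp_potential (R : realType) (n m1 m2 : nat)
    (alpha S0 : 'M[R[i]]_n) (theta1 : 'M[R[i]]_(n, m1))
    (theta2 : 'M[R[i]]_(n, m2)) (x : R) : 'M[R[i]]_(m1, m2) :=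
  2%:R *: (theta1^t* *m expmx (('i%C * x%:C) *: alpha^t*)
           *m invmx (Smx alpha S0 theta1 theta2 x)
           *m expmx (('i%C * x%:C) *: alpha) *m theta2).

(* Main.v *)
(** Put B(x) = e^(-2ix alpha) theta1 and R(x) = e^(-ix alpha) S(x) e^(ix alpha^* ).
    Differentiating alpha S - S alpha^* - i Lambda Lambda^* shows that it vanishes
    identically, and this yields R' = 2 B B^*, R(0) = S0, v = 2 B^* R^-1 theta2 and
    alpha R - R alpha^* = i (B B^* + theta2 theta2^* ).  Taking the trace after
    multiplication by R^-1,
      tr (B^* R^-1 B) + tr (theta2^* R^-1 theta2) = 2 Im (tr alpha),
    so the Cauchy-Schwarz inequality bounds |v(x)|^2 by a constant times
    Im (tr alpha) * tr (theta2^* R(x)^-1 theta2).  Since R increases, the last trace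
    is nonincreasing in x: v is small on [M, oo[ as soon as that trace is small at
    the single point M, and this condition at M persists under perturbation of the
    quadruple, without any control of the spectrum of the perturbed alpha.  On [0, M]
    the potential depends uniformly continuously on the quadruple.

    That the trace tends to 0 for the unperturbed quadruple comes from
    R(x + 1) - R(x) = E (R(1) - R(0)) E^* with E = e^(-2ix alpha).  Controllability
    makes R(1) - R(0) positive definite, hence >= c S0 for some c > 0, and
    E S0 E^* >= S0; so R grows at least linearly. *)
Require Import Defs.
From mathcomp Require Import ring lra.

Import Order.TTheory GRing.Theory Num.Theory.
Import numFieldNormedType.Exports.

Set Implicit Arguments.
Unset Strict Implicit.
Unset Printing Implicit Defensive.

Local Open Scope classical_set_scope.
Local Open Scope complex_scope.
Local Open Scope sesquilinear_scope.
Local Open Scope ring_scope.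

(** * Moduli, adjoints and matrix norms *)

(** Three obstacles shape the argument. First, [tr (B^* R^-1 B)] is bounded but not small: as the
    theta2-trace vanishes in the limit, it tends to [2 Im (tr alpha)]. Cauchy-Schwarz is therefore
    used in the weighted form [s a + s^-1 b]: the weight s makes the bounded term small, and only
    then is M chosen so that the other term is small despite the factor [s^-1]. Second, E need not
    expand the standard Hermitian form. Admissibility makes it expand the form S0 only, so R(1) -
    R(0) is compared with S0 before E acts: if R(1) - R(0) >= c and S0 <= r, then R(1) - R(0) >=
    (c/r) S0, and each unit step adds at least (c/r) S0 >= (c/r) c0, where c0 is a lower bound of
    S0. Third, no perturbation estimate is made for S(x). On [0, M] the matrix R is controlled
    through its initial value S0 and its derivative, a Gram matrix of B; its inverse is controlled
    because R(x) >= S0 bounds R(x) below uniformly in x, and half of this bound survives in all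
    nearby quadruples. *)

Section Modulus.
Variable R : realType.
Implicit Types z w : R[i].

Lemma normc_ge0 z : 0 <= Normc.normc z.
Proof. by case: z => a b; apply: sqrtr_ge0. Qed.

Lemma normcD z w : Normc.normc (z + w) <= Normc.normc z + Normc.normc w.
Proof. exact: le_normcD. Qed.

Lemma normcB z : Normc.normc (- z) = Normc.normc z.
Proof. exact: normcN. Qed.

Lemma normc_conj z : Normc.normc (Num.conj z) = Normc.normc z.
Proof. by case: z => a b /=; rewrite sqrrN. Qed.

Lemma normc_real (x : R) : Normc.normc x%:C = `|x|.
Proof. by rewrite /= expr0n addr0 sqrtr_sqr. Qed.

Lemma normc_i : Normc.normc ('i%C : R[i]) = 1.
Proof. by rewrite /= expr0n expr1n add0r sqrtr1. Qed.

Lemma normr_normc z : `|z| = (Normc.normc z)%:C.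
Proof. by case: z => a b; rewrite normc_def. Qed.

Lemma Re_le_normc z : `|complex.Re z| <= Normc.normc z.
Proof. by rewrite -lecR -normr_normc; apply: normc_ge_Re. Qed.

Lemma Im_le_normc z : `|complex.Im z| <= Normc.normc z.
Proof.
case: z => a b /=; rewrite -sqrtr_sqr ler_sqrt ?addr_ge0 ?sqr_ge0//.
by rewrite lerDr sqr_ge0.
Qed.

Lemma normc_le_ReIm z :
  Normc.normc z <= `|complex.Re z| + `|complex.Im z|.
Proof.
case: z => a b /=; rewrite -[leRHS]ger0_norm ?addr_ge0// -sqrtr_sqr.
rewrite ler_sqrt ?sqr_ge0// sqrrD !real_normK ?num_real//.
by rewrite lerD2r lerDl mulrn_wge0// mulr_ge0.
Qed.

Lemma normc_sum (I : finType) (F : I -> R[i]) :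
  Normc.normc (\sum_i F i) <= \sum_i Normc.normc (F i).
Proof.
elim/big_rec2: _ => [|i x y _ xy]; first by rewrite Normc.normc0.
by rewrite (le_trans (normcD _ _))// lerD2l.
Qed.

End Modulus.

Section Adjoint.
Variable C : numClosedFieldType.

Lemma adjM m n p (A : 'M[C]_(m, n)) (B : 'M[C]_(n, p)) :
  (A *m B)^t* = B^t* *m A^t*.
Proof. by rewrite trmx_mul map_mxM. Qed.

Lemma adjD m n (A B : 'M[C]_(m, n)) : (A + B)^t* = A^t* + B^t*.
Proof. by rewrite linearD map_mxD. Qed.

Lemma adjN m n (A : 'M[C]_(m, n)) : (- A)^t* = - A^t*.
Proof. by rewrite linearN map_mxN. Qed.

Lemma adjB m n (A B : 'M[C]_(m, n)) : (A - B)^t* = A^t* - B^t*.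
Proof. by rewrite adjD adjN. Qed.

Lemma adjZ m n (c : C) (A : 'M[C]_(m, n)) : (c *: A)^t* = Num.conj c *: A^t*.
Proof. by rewrite linearZ map_mxZ. Qed.

Lemma adj1 n : (1%:M : 'M[C]_n)^t* = 1%:M.
Proof. by rewrite trmx1 map_mx1. Qed.

Lemma adjV n (A : 'M[C]_n) : (invmx A)^t* = invmx (A^t*).
Proof. by rewrite trmx_inv map_invmx. Qed.

End Adjoint.

(** * The entrywise sum norm and its equivalence with the operator norm *)

Section EntrywiseNorm.
Variable R : realType.

(* The sum of the moduli of the entries; unlike [opnorm] it is submultiplicative
   by a finite computation, and equivalent to it in finite dimension. *)
Definition nrm m n (A : 'M[R[i]]_(m, n)) : R :=
  \sum_i \sum_j Normc.normc (A i j).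

Lemma nrm_ge0 m n (A : 'M[R[i]]_(m, n)) : 0 <= nrm A.
Proof. by apply: sumr_ge0 => i _; apply: sumr_ge0 => j _; apply: normc_ge0. Qed.

Lemma entry_le_nrm m n (A : 'M[R[i]]_(m, n)) i j : Normc.normc (A i j) <= nrm A.
Proof.
rewrite /nrm (bigD1 i)//= (bigD1 j)//= -addrA lerDl addr_ge0 ?sumr_ge0//.
  by move=> k _; apply: normc_ge0.
by move=> k _; apply: sumr_ge0 => l _; apply: normc_ge0.
Qed.

Lemma nrm0 m n : nrm (0 : 'M[R[i]]_(m, n)) = 0.
Proof.
rewrite /nrm big1// => i _; rewrite big1// => j _.
by rewrite mxE Normc.normc0.
Qed.

Lemma nrmD m n (A B : 'M[R[i]]_(m, n)) : nrm (A + B) <= nrm A + nrm B.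
Proof.
rewrite -big_split; apply: ler_sum => i _; rewrite -big_split.
by apply: ler_sum => j _; rewrite mxE; apply: normcD.
Qed.

Lemma nrmN m n (A : 'M[R[i]]_(m, n)) : nrm (- A) = nrm A.
Proof. by apply: eq_bigr => i _; apply: eq_bigr => j _; rewrite mxE normcB. Qed.

Lemma nrmB m n (A B : 'M[R[i]]_(m, n)) : nrm (A - B) = nrm (B - A).
Proof. by rewrite -nrmN opprB. Qed.

Lemma nrmZ m n c (A : 'M[R[i]]_(m, n)) : nrm (c *: A) = Normc.normc c * nrm A.
Proof.
rewrite mulr_sumr; apply: eq_bigr => i _; rewrite mulr_sumr.
by apply: eq_bigr => j _; rewrite mxE Normc.normcM.
Qed.

Lemma nrm_adj m n (A : 'M[R[i]]_(m, n)) : nrm (A^t*) = nrm A.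
Proof.
rewrite /nrm exchange_big; apply: eq_bigr => i _; apply: eq_bigr => j _.
by rewrite !mxE normc_conj.
Qed.

Lemma nrmM m n p (A : 'M[R[i]]_(m, n)) (B : 'M[R[i]]_(n, p)) :
  nrm (A *m B) <= nrm A * nrm B.
Proof.
rewrite /nrm mulr_suml; apply: ler_sum => i _.
apply: (@le_trans _ _ (\sum_j \sum_k Normc.normc (A i k) * Normc.normc (B k j))).
  apply: ler_sum => j _; rewrite mxE (le_trans (normc_sum _))//.
  by apply: ler_sum => k _; rewrite Normc.normcM.
rewrite exchange_big mulr_suml; apply: ler_sum => k _.
rewrite -mulr_sumr ler_wpM2l ?normc_ge0//.
rewrite [leRHS](bigD1 k)//= lerDl sumr_ge0// => l _.
by apply: sumr_ge0 => j _; apply: normc_ge0.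
Qed.

Lemma nrm_le_entries m n (A : 'M[R[i]]_(m, n)) e :
  (forall i j, Normc.normc (A i j) <= e) -> nrm A <= (m * n)%:R * e.
Proof.
move=> Ae; rewrite /nrm (@le_trans _ _ (\sum_(i < m) \sum_(j < n) e))//.
  by apply: ler_sum => i _; apply: ler_sum => j _.
by rewrite !sumr_const !card_ord -mulrnA mulr_natl mulnC.
Qed.

Lemma nrm_tr n (A : 'M[R[i]]_n) : Normc.normc (\tr A) <= nrm A.
Proof.
rewrite (le_trans (normc_sum _))//; apply: ler_sum => i _.
by rewrite (bigD1 i)//= lerDl sumr_ge0// => j _; apply: normc_ge0.
Qed.

Lemma sum_sqr_le (I : finType) (F : I -> R) :
  (forall i, 0 <= F i) -> \sum_i F i ^+ 2 <= (\sum_i F i) ^+ 2.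
Proof.
move=> F0; rewrite expr2 mulr_suml; apply: ler_sum => i _.
rewrite expr2 ler_wpM2l// (bigD1 i)//= lerDl sumr_ge0//.
Qed.

Lemma l2norm_le_nrm n (u : 'cV[R[i]]_n) : l2norm u <= nrm u.
Proof.
rewrite -[leRHS]ger0_norm ?nrm_ge0// -sqrtr_sqr ler_sqrt ?sqr_ge0//.
rewrite /nrm; under [in leRHS]eq_bigr do rewrite big_ord1.
by apply: sum_sqr_le => i; apply: normc_ge0.
Qed.

Lemma entry_le_l2norm n (u : 'cV[R[i]]_n) i : Normc.normc (u i 0) <= l2norm u.
Proof.
rewrite -[leLHS]ger0_norm ?normc_ge0// -sqrtr_sqr ler_sqrt ?sumr_ge0//.
  by rewrite [leRHS](bigD1 i)//= lerDl sumr_ge0// => j _; rewrite sqr_ge0.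
by move=> j _; rewrite sqr_ge0.
Qed.

Lemma l2norm_mul_le m n (A : 'M[R[i]]_(m, n)) (u : 'cV[R[i]]_n) :
  l2norm u <= 1 -> l2norm (A *m u) <= nrm A.
Proof.
move=> u1; apply: le_trans (l2norm_le_nrm _) _.
apply: ler_sum => i _; rewrite big_ord1 mxE (le_trans (normc_sum _))//.
apply: ler_sum => k _; rewrite Normc.normcM ler_piMr ?normc_ge0//.
by rewrite (le_trans (entry_le_l2norm _ _)).
Qed.

Lemma l2norm0 n : l2norm (0 : 'cV[R[i]]_n) <= 1.
Proof. by rewrite (le_trans (l2norm_le_nrm _))// nrm0. Qed.

Lemma opnorm_le_nrm m n (A : 'M[R[i]]_(m, n)) : opnorm A <= nrm A.
Proof.
apply: ge_sup.
  exists (l2norm (A *m 0)), 0 => //=.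
  exact: l2norm0.
by move=> _ [u /= u1 <-]; apply: l2norm_mul_le.
Qed.

(** A supremum has content only for a set bounded above; [nrm A] supplies the bound. *)
Lemma l2norm_mul_le_opnorm m n (A : 'M[R[i]]_(m, n)) (u : 'cV[R[i]]_n) :
  l2norm u <= 1 -> l2norm (A *m u) <= opnorm A.
Proof.
move=> u1; apply: sup_ubound; last by exists u.
by exists (nrm A) => _ [w /= w1 <-]; apply: l2norm_mul_le.
Qed.

Lemma entry_le_opnorm m n (A : 'M[R[i]]_(m, n)) i j :
  Normc.normc (A i j) <= opnorm A.
Proof.
pose u : 'cV[R[i]]_n := delta_mx j 0.
have -> : A i j = (A *m u) i 0.
  rewrite mxE (bigD1 j)//= big1 => [|k kj]; rewrite mxE ?eqxx ?mulr1 ?addr0//.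
  by rewrite (negbTE kj) mulr0.
apply: le_trans (entry_le_l2norm _ _) (l2norm_mul_le_opnorm _ _).
apply: le_trans (l2norm_le_nrm _) _.
rewrite /nrm (bigD1 j)//= big_ord1 big1 ?addr0.
  by rewrite mxE !eqxx Normc.normc1.
by move=> k kj; rewrite big_ord1 mxE (negbTE kj) Normc.normc0.
Qed.

Lemma opnorm_ge0 m n (A : 'M[R[i]]_(m, n)) : 0 <= opnorm A.
Proof. exact: le_trans (sqrtr_ge0 _) (l2norm_mul_le_opnorm A (l2norm0 n)). Qed.

Lemma nrm_le_opnorm m n (A : 'M[R[i]]_(m, n)) :
  nrm A <= (m * n)%:R * opnorm A.
Proof. by apply: nrm_le_entries => i j; apply: entry_le_opnorm. Qed.

End EntrywiseNorm.

(** * Entrywise derivatives of matrix functions *)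

Section EntrywiseDerivative.
Variable R : realType.

Lemma MVT_segment_derivable (f df : R -> R) (a b : R) : a <= b ->
  (forall x, a <= x <= b -> is_derive x 1 f (df x)) ->
  exists2 c, a <= c <= b & f b - f a = df c * (b - a).
Proof.
move=> ab fdf.
have [||c] := @MVT_segment R f df a b ab.
- by move=> x xab; apply: fdf; rewrite !(itvP xab).
- apply: derivable_within_continuous => x xab.
  by have [] := fdf x _; rewrite ?(itvP xab).
by move=> cab; exists c => //; rewrite !(itvP cab).
Qed.

(** Real and imaginary parts are differentiated separately because the mean value theorem is a
    statement about real functions and [mxintegral] is also defined part by part. *)
Definition cder (f : R -> R[i]) (x : R) (d : R[i]) : Prop :=
  is_derive x 1 (fun t => complex.Re (f t)) (complex.Re d) /\
  is_derive x 1 (fun t => complex.Im (f t)) (complex.Im d).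

Definition mder m n (F : R -> 'M[R[i]]_(m, n)) (x : R) (D : 'M[R[i]]_(m, n)) :
  Prop := forall k l, cder (fun t => F t k l) x (D k l).

Lemma cder_cst (c : R[i]) x : cder (fun _ => c) x 0.
Proof. by split; apply: is_derive_cst. Qed.

Lemma cderD f g x d e : cder f x d -> cder g x e ->
  cder (fun t => f t + g t) x (d + e).
Proof.
move=> [fr fi] [gr gi]; split.
  rewrite [X in is_derive _ _ X _](_ : _ =
    (fun t => complex.Re (f t)) + (fun t => complex.Re (g t))); last first.
    by apply/funext => t; apply: raddfD.
  by rewrite raddfD; apply: is_deriveD.
rewrite [X in is_derive _ _ X _](_ : _ =
  (fun t => complex.Im (f t)) + (fun t => complex.Im (g t))); last first.
  by apply/funext => t; apply: raddfD.
by rewrite raddfD; apply: is_deriveD.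
Qed.

Lemma cderM f g x d e : cder f x d -> cder g x e ->
  cder (fun t => f t * g t) x (d * g x + f x * e).
Proof.
move=> [fr fi] [gr gi]; split.
  rewrite [X in is_derive _ _ X _](_ : _ =
    (fun t => complex.Re (f t)) * (fun t => complex.Re (g t)) -
    (fun t => complex.Im (f t)) * (fun t => complex.Im (g t))); last first.
    by apply/funext => t; rewrite !fctE; case: (f t) => a b; case: (g t) => c s.
  apply: is_derive_eq.
  rewrite /GRing.scale/=; case: (f x) => ? ?; case: (g x) => ? ?.
  by case: d {fr fi} => ? ?; case: e {gr gi} => ? ? /=; ring.
rewrite [X in is_derive _ _ X _](_ : _ =
  (fun t => complex.Re (f t)) * (fun t => complex.Im (g t)) +
  (fun t => complex.Im (f t)) * (fun t => complex.Re (g t))); last first.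
  by apply/funext => t; rewrite !fctE; case: (f t) => a b; case: (g t) => c s.
apply: is_derive_eq.
rewrite /GRing.scale/=; case: (f x) => ? ?; case: (g x) => ? ?.
by case: d {fr fi} => ? ?; case: e {gr gi} => ? ? /=; ring.
Qed.

Lemma cder_conj f x d : cder f x d ->
  cder (fun t => Num.conj (f t)) x (Num.conj d).
Proof.
move=> [fr fi]; split.
  rewrite [X in is_derive _ _ X _](_ : _ = fun t => complex.Re (f t)).
    by case: d fr fi.
  by apply/funext => t; case: (f t).
rewrite [X in is_derive _ _ X _](_ : _ = - (fun t => complex.Im (f t))).
  by case: d fr fi => ? ? /= fr fi; apply: is_deriveN.
by apply/funext => t; rewrite fctE; case: (f t).
Qed.

Lemma cder_shift f x s d : cder f (x + s) d -> cder (fun t => f (t + s)) x d.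
Proof.
have rshift (g : R -> R) e : is_derive (x + s) 1 g e ->
    is_derive x 1 (fun t => g (t + s)) e.
  move=> ge; have := @is_derive1_comp _ g (id + cst s) x e 1.
  rewrite mulr1; apply => //.
  by have := is_deriveD (is_derive_id x (1 : R)) (is_derive_cst s x 1); rewrite addr0.
by move=> [fr fi]; split; apply: rshift.
Qed.

Lemma cder_sum (I : finType) (f : I -> R -> R[i]) x d :
  (forall k, cder (f k) x (d k)) ->
  cder (fun t => \sum_k f k t) x (\sum_k d k).
Proof.
move=> fd; rewrite (_ : (fun t => _) = \sum_k f k).
  elim/big_rec2: _ => [|k g e _ ge]; first exact: cder_cst.
  exact: cderD.
by apply/funext => t; rewrite fct_sumE.
Qed.

Lemma mder_eq m n (F : R -> 'M[R[i]]_(m, n)) x D E :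
  mder F x D -> D = E -> mder F x E.
Proof. by move=> FD <-. Qed.

Lemma mder_cst m n (A : 'M[R[i]]_(m, n)) x : mder (fun _ => A) x 0.
Proof. by move=> k l; rewrite mxE; apply: cder_cst. Qed.

Lemma mderD m n (F G : R -> 'M[R[i]]_(m, n)) x D E :
  mder F x D -> mder G x E -> mder (fun t => F t + G t) x (D + E).
Proof.
move=> FD GE k l; rewrite mxE (_ : (fun t => _) = fun t => F t k l + G t k l).
  exact: cderD.
by apply/funext => t; rewrite mxE.
Qed.

Lemma mderM m n p (F : R -> 'M[R[i]]_(m, n)) (G : R -> 'M[R[i]]_(n, p)) x D E :
  mder F x D -> mder G x E ->
  mder (fun t => F t *m G t) x (D *m G x + F x *m E).
Proof.
move=> FD GE k l.
rewrite (_ : (fun t => _) = fun t => \sum_j F t k j * G t j l); last first.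
  by apply/funext => t; rewrite mxE.
by rewrite !mxE -big_split/=; apply: cder_sum => j; apply: cderM.
Qed.

Lemma mderMl m n p (A : 'M[R[i]]_(m, n)) (G : R -> 'M[R[i]]_(n, p)) x E :
  mder G x E -> mder (fun t => A *m G t) x (A *m E).
Proof.
by move=> /(mderM (mder_cst A x)) h; apply: mder_eq h _; rewrite mul0mx add0r.
Qed.

Lemma mderMr m n p (A : 'M[R[i]]_(n, p)) (F : R -> 'M[R[i]]_(m, n)) x D :
  mder F x D -> mder (fun t => F t *m A) x (D *m A).
Proof.
by move=> /mderM/(_ (mder_cst A x)) h; apply: mder_eq h _; rewrite mulmx0 addr0.
Qed.

Lemma mderZ m n (c : R[i]) (F : R -> 'M[R[i]]_(m, n)) x D :
  mder F x D -> mder (fun t => c *: F t) x (c *: D).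
Proof.
move=> FD; rewrite (_ : (fun t => _) = fun t => c%:M *m F t).
  by rewrite -mul_scalar_mx; apply: mderMl.
by apply/funext => t; rewrite mul_scalar_mx.
Qed.

Lemma mderN m n (F : R -> 'M[R[i]]_(m, n)) x D :
  mder F x D -> mder (fun t => - F t) x (- D).
Proof.
rewrite -scaleN1r (_ : (fun t => - F t) = fun t => -1 *: F t).
  exact: mderZ.
by apply/funext => t; rewrite scaleN1r.
Qed.

Lemma mderB m n (F G : R -> 'M[R[i]]_(m, n)) x D E :
  mder F x D -> mder G x E -> mder (fun t => F t - G t) x (D - E).
Proof. by move=> FD /mderN; apply: mderD. Qed.

Lemma mder_adj m n (F : R -> 'M[R[i]]_(m, n)) x D :
  mder F x D -> mder (fun t => (F t)^t*) x (D^t*).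
Proof.
move=> FD k l; rewrite !mxE (_ : (fun t => _) = fun t => Num.conj (F t l k)).
  exact: cder_conj.
by apply/funext => t; rewrite !mxE.
Qed.

Lemma mder_shift m n (F : R -> 'M[R[i]]_(m, n)) x s D :
  mder F (x + s) D -> mder (fun t => F (t + s)) x D.
Proof. by move=> FD k l; apply: (@cder_shift (fun t => F t k l)). Qed.

(** The mean value theorem yields different intermediate points for the two parts, hence the factor
    2. *)
Lemma cder_bound (f : R -> R[i]) (d : R -> R[i]) (a b K : R) : a <= b ->
  (forall x, a <= x <= b -> cder f x (d x)) ->
  (forall x, a <= x <= b -> Normc.normc (d x) <= K) ->
  Normc.normc (f b - f a) <= 2 * K * (b - a).
Proof.
move=> ab fd dK; rewrite (le_trans (normc_le_ReIm _))// !raddfB/=.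
have [|c ca ->] := @MVT_segment_derivable (fun t => complex.Re (f t))
  (fun x => complex.Re (d x)) a b ab.
  by move=> x /fd[].
have [|e ea ->] := @MVT_segment_derivable (fun t => complex.Im (f t))
  (fun x => complex.Im (d x)) a b ab.
  by move=> x /fd[].
rewrite !normrM (ger0_norm (_ : 0 <= b - a)) ?subr_ge0// -mulrDl.
rewrite ler_wpM2r ?subr_ge0// mulr_natl mulr2n lerD//.
  by rewrite (le_trans (Re_le_normc _))// dK.
by rewrite (le_trans (Im_le_normc _))// dK.
Qed.

Lemma mder_bound m n (F D : R -> 'M[R[i]]_(m, n)) (a b K : R) : a <= b ->
  (forall x, a <= x <= b -> mder F x (D x)) ->
  (forall x, a <= x <= b -> nrm (D x) <= K) ->
  nrm (F b - F a) <= (m * n)%:R * (2 * K * (b - a)).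
Proof.
move=> ab FD DK; apply: nrm_le_entries => k l; rewrite !mxE.
apply: (@cder_bound (fun t => F t k l) (fun t => D t k l)) => // x xab.
  exact: FD.
by rewrite (le_trans (entry_le_nrm _ _ _))// DK.
Qed.

(** The uniqueness principle behind the identities between matrix functions below: the difference of
    the two sides has zero derivative. Derivatives are two-sided even at the endpoints, so functions
    given on x >= 0 must first be extended to the left of 0. *)
Lemma mder0_constant m n (F : R -> 'M[R[i]]_(m, n)) (a b : R) : a <= b ->
  (forall x, a <= x <= b -> mder F x 0) -> F b = F a.
Proof.
move=> ab FD.
have h : nrm (F b - F a) <= 0.
  rewrite (le_trans (@mder_bound m n F (fun _ => 0) a b 0 ab FD _))//.
    by move=> x _; rewrite nrm0.
  by rewrite mulr0 mul0r mulr0.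
apply/matrixP => k l; apply/eqP; rewrite -subr_eq0.
apply/eqP/Normc.eq0_normc/le_anti; rewrite normc_ge0 andbT.
by apply: le_trans h; have := entry_le_nrm (F b - F a) k l; rewrite !mxE.
Qed.

Lemma cder_unique (f : R -> R[i]) x d e : cder f x d -> cder f x e -> d = e.
Proof.
move=> [[_ r] [_ s]] [[_ r'] [_ s']]; move: r r' s s' => -> + ->.
by case: d => ? ?; case: e => ? ? /= -> ->.
Qed.

Lemma mder_unique m n (F : R -> 'M[R[i]]_(m, n)) x D E :
  mder F x D -> mder F x E -> D = E.
Proof. by move=> FD FE; apply/matrixP => k l; apply: cder_unique (FD k l) (FE k l). Qed.

(** Allows an identity known only on an open interval to be differentiated at its interior
    points. *)
Lemma cder_near (f g : R -> R[i]) (a b x : R) d : a < x < b ->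
  (forall t, a < t < b -> f t = g t) -> cder f x d -> cder g x d.
Proof.
move=> /andP[ax xb] fg [fr fi].
have nearfg : \forall t \near x, f t = g t.
  near=> t; apply: fg; apply/andP; split; near: t.
    exact: lt_nbhsr.
  exact: lt_nbhsl.
split; [apply: near_eq_is_derive fr|apply: near_eq_is_derive fi];
  by apply: filterS nearfg => t ->.
Unshelve. all: by end_near. Qed.

Lemma mder_near m n (F G : R -> 'M[R[i]]_(m, n)) (a b x : R) D : a < x < b ->
  (forall t, a < t < b -> F t = G t) -> mder F x D -> mder G x D.
Proof.
move=> axb FG FD k l; apply: (cder_near (f := fun t => F t k l) axb) (FD k l).
by move=> t /FG ->.
Qed.

End EntrywiseDerivative.

(** * The matrix exponential *)

Section MatrixExponential.
Variable R : realType.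

Lemma cvg_complex (u : nat -> R[i]) (z : R[i]) :
  (fun k => complex.Re (u k)) @ \oo --> complex.Re z ->
  (fun k => complex.Im (u k)) @ \oo --> complex.Im z ->
  (u : nat -> R[i]^o) @ \oo --> (z : R[i]^o).
Proof.
move=> /cvgrPdist_lt ur /cvgrPdist_lt ui; apply/cvgrPdist_lt => -[e e'].
rewrite ltcE/= => /andP[/eqP-> e0].
have e2 : 0 < e / 2 by rewrite divr_gt0.
near=> k; suff: Normc.normc (z - u k) < e by rewrite -ltcR.
rewrite (le_lt_trans (normc_le_ReIm _))//.
rewrite (splitr e) ltrD// !raddfB/=; near: k.
  exact: ur.
exact: ui.
Unshelve. all: by end_near. Qed.

Lemma cvg_complex_Re (u : nat -> R[i]) (z : R[i]) :
  (u : nat -> R[i]^o) @ \oo --> (z : R[i]^o) ->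
  (fun k => complex.Re (u k)) @ \oo --> complex.Re z.
Proof.
move=> /cvgrPdist_lt uz; apply/cvgrPdist_lt => e e0.
have e0' : 0 < e%:C by rewrite ltcR.
apply: filterS (uz _ e0') => k h.
have : Normc.normc (z - u k) < e by rewrite -ltcR.
by apply: le_lt_trans; rewrite -raddfB Re_le_normc.
Qed.

Lemma cvg_complex_Im (u : nat -> R[i]) (z : R[i]) :
  (u : nat -> R[i]^o) @ \oo --> (z : R[i]^o) ->
  (fun k => complex.Im (u k)) @ \oo --> complex.Im z.
Proof.
move=> /cvgrPdist_lt uz; apply/cvgrPdist_lt => e e0.
have e0' : 0 < e%:C by rewrite ltcR.
apply: filterS (uz _ e0') => k h.
have : Normc.normc (z - u k) < e by rewrite -ltcR.
by apply: le_lt_trans; rewrite -raddfB Im_le_normc.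
Qed.

Lemma cvg_mx_entries m n (u : nat -> 'M[R[i]^o]_(m, n)) (M : 'M[R[i]^o]_(m, n)) :
  (forall k l, (fun N => u N k l) @ \oo --> M k l) -> u @ \oo --> M.
Proof.
move=> uM A [P MP sPA].
have : \forall N \near \oo, forall k l, P k l (u N k l).
  apply: filter_forall => k; apply: filter_forall => l.
  exact: uM (MP k l).
by apply: filterS => N PN; apply: sPA.
Qed.

(** Uniqueness of the limit is obtained entry by entry, from the Hausdorff topology of [R[i]^o]. *)
Lemma mx_limn m n (u : nat -> 'M[R[i]^o]_(m, n)) (M : 'M[R[i]^o]_(m, n)) :
  u @ \oo --> M -> limn u = M.
Proof.
move=> uM; have uL : u @ \oo --> limn u by apply/cvgP: uM.
apply/matrixP => k l.
have coord (L : 'M[R[i]^o]_(m, n)) :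
    u @ \oo --> L -> (fun N => u N k l) @ \oo --> L k l.
  by move=> uL'; apply: (cvg_comp _ _ uL' (@coord_continuous R[i] m n k l L)).
exact: (cvg_unique (@norm_hausdorff _ R[i]^o) (coord _ uL) (coord _ uM)).
Qed.

Lemma exprZmx n (c : R[i]) (A : 'M[R[i]]_n) k : (c *: A) ^+ k = c ^+ k *: A ^+ k.
Proof.
elim: k => [|k IH]; first by rewrite !expr0 scale1r.
rewrite !exprS IH.
change (c *: A *m (c ^+ k *: A ^+ k) = (c * c ^+ k) *: (A *m A ^+ k)).
by rewrite -scalemxAl -scalemxAr scalerA.
Qed.

Lemma entry_expr_le n (A : 'M[R[i]]_n) k l j :
  Normc.normc ((A ^+ j) k l) <= nrm A ^+ j.
Proof.
elim: j k l => [|j IH] k l.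
  rewrite !expr0; have -> : (1 : 'M[R[i]]_n) = 1%:M by [].
  by rewrite mxE; case: eqP => _; rewrite ?Normc.normc1 ?Normc.normc0.
rewrite !exprS; have -> : A * A ^+ j = A *m A ^+ j by [].
rewrite mxE (le_trans (normc_sum _))// /nrm mulr_suml.
rewrite [leRHS](bigD1 k)//= ler_wpDr//.
  rewrite sumr_ge0// => i _; rewrite mulr_ge0 ?exprn_ge0 ?nrm_ge0//.
  by rewrite sumr_ge0// => ? _; rewrite normc_ge0.
rewrite mulr_suml ler_sum// => i _; rewrite Normc.normcM.
by rewrite ler_wpM2l ?normc_ge0.
Qed.

(** Comparison with the exponential series. The factor L leaves room for shifted coefficients:
    passing from [c j] to [c j.+1] multiplies L by K. *)
Lemma is_cvg_exp_dominated (c : nat -> R) (K L : R) :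
  (forall j, `|c j| <= L * K ^+ j) ->
  cvgn (series (fun j => j`!%:R^-1 * c j)).
Proof.
move=> cK; apply: normed_cvg.
apply: (@series_le_cvg R _ (fun j => L * exp_coeff K j)).
- by move=> j; apply: normr_ge0.
- move=> j; rewrite (le_trans (normr_ge0 (j`!%:R^-1 * c j)))//.
  rewrite normrM ger0_norm ?invr_ge0// mulrC /exp_coeff/= mulrA.
  by rewrite ler_wpM2r ?invr_ge0.
- move=> j /=; rewrite normrM ger0_norm ?invr_ge0// mulrC /exp_coeff/= mulrA.
  by rewrite ler_wpM2r ?invr_ge0.
exact: (@is_cvg_seriesZ _ (exp_coeff K) L (is_cvg_series_exp_coeff K)).
Qed.

Lemma lim_exp_dominated (c : nat -> R) (K : R) :
  (forall j, `|c j| <= K ^+ j) ->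
  `|limn (series (fun j => j`!%:R^-1 * c j))| <= expR K.
Proof.
move=> cK.
have cK' j : `|c j| <= 1 * K ^+ j by rewrite mul1r.
have Nc : cvgn [normed series (fun j => j`!%:R^-1 * c j)].
  have := @is_cvg_exp_dominated (fun j => `|c j|) K 1.
  rewrite (_ : (fun j => _ * `|c j|) = fun j => `|j`!%:R^-1 * c j|).
    by apply => j; rewrite normr_id.
  by apply/funext => j; rewrite normrM (ger0_norm (_ : 0 <= j`!%:R^-1)) ?invr_ge0.
apply: le_trans (lim_series_norm Nc) _.
apply: lim_series_le => //; first exact: is_cvg_series_exp_coeff.
move=> j /=; rewrite normrM ger0_norm ?invr_ge0// mulrC /exp_coeff/=.
by rewrite ler_wpM2r ?invr_ge0.
Qed.

Lemma is_derive_exp_dominated (c : nat -> R) (K L x : R) :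
  0 <= K -> (forall j, `|c j| <= L * K ^+ j) ->
  is_derive x 1 (fun t => limn (series (fun j => j`!%:R^-1 * (c j * t ^+ j))))
    (limn (series (fun j => j`!%:R^-1 * (c j.+1 * x ^+ j)))).
Proof.
move=> K0 cK; pose a j : R := j`!%:R^-1 * c j.
have diffsE (b : nat -> R) : pseries_diffs (fun j => j`!%:R^-1 * b j) =
    fun j => j`!%:R^-1 * b j.+1.
  apply/funext => j; rewrite /pseries_diffs factS natrM invfM !mulrA.
  by rewrite divff ?mul1r// pnatr_eq0.
have cvg_b (b : nat -> R) L' t : (forall j, `|b j| <= L' * K ^+ j) ->
    cvgn (pseries (fun j => j`!%:R^-1 * b j) t).
  move=> bK; rewrite /pseries.
  rewrite (_ : (fun j => _) = fun j => j`!%:R^-1 * (b j * t ^+ j)); last first.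
    by apply/funext => j; rewrite mulrA.
  apply: (@is_cvg_exp_dominated _ (K * `|t|) L') => j.
  by rewrite normrM normrX exprMn mulrA ler_wpM2r// exprn_ge0.
have shiftK (b : nat -> R) L' : (forall j, `|b j| <= L' * K ^+ j) ->
    forall j, `|b j.+1| <= (L' * K) * K ^+ j.
  by move=> bK j; rewrite -mulrA -exprS.
(* Termwise differentiation asks for convergence of the series and of its first two formal
   derivatives at a point of modulus greater than [|x|]; [|x| + 1] is such a point. *)
have := @pseries_snd_diffs R a (`|x| + 1) x; rewrite /a !diffsE.
have xx : `|x| < `| `|x| + 1 |.
  by rewrite [ltRHS]ger0_norm ?addr_ge0// ltrDl.
move=> /(_ (cvg_b _ _ _ cK) (cvg_b _ _ _ (shiftK _ _ cK))).
move=> /(_ (cvg_b _ _ _ (shiftK _ _ (shiftK _ _ cK))) xx).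
rewrite /pseries; under [X in is_derive _ _ X _]eq_fun => t.
  under [X in series X]eq_fun do rewrite -mulrA.
  over.
by under [X in series X]eq_fun do rewrite -mulrA.
Qed.

Definition exp_partial n (A : 'M[R[i]]_n) : nat -> 'M[R[i]^o]_n :=
  series (fun k : nat => (k`!%:R^-1 *: A ^+ k) : 'M[R[i]^o]_n).

Lemma Re_exp_partial n (A : 'M[R[i]]_n) k l N :
  complex.Re (exp_partial A N k l) =
  series (fun j => j`!%:R^-1 * complex.Re ((A ^+ j) k l)) N.
Proof.
rewrite /exp_partial !seriesEnat /= summxE raddf_sum; apply: eq_bigr => j _.
rewrite mxE; case: ((A ^+ j) k l) => a b /=.
by rewrite -(rmorph_nat (real_complex R)) -fmorphV /= mul0r subr0.
Qed.

Lemma Im_exp_partial n (A : 'M[R[i]]_n) k l N :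
  complex.Im (exp_partial A N k l) =
  series (fun j => j`!%:R^-1 * complex.Im ((A ^+ j) k l)) N.
Proof.
rewrite /exp_partial !seriesEnat /= summxE raddf_sum; apply: eq_bigr => j _.
rewrite mxE; case: ((A ^+ j) k l) => a b /=.
by rewrite -(rmorph_nat (real_complex R)) -fmorphV /= mul0r addr0.
Qed.

Lemma Re_entry_expr_le n (A : 'M[R[i]]_n) k l j :
  `|complex.Re ((A ^+ j) k l)| <= nrm A ^+ j.
Proof. exact: le_trans (Re_le_normc _) (entry_expr_le _ _ _ _). Qed.

Lemma Im_entry_expr_le n (A : 'M[R[i]]_n) k l j :
  `|complex.Im ((A ^+ j) k l)| <= nrm A ^+ j.
Proof. exact: le_trans (Im_le_normc _) (entry_expr_le _ _ _ _). Qed.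

(** Reduces the matrix limit to real series, where power series can be differentiated termwise. *)
Lemma expmxE n (A : 'M[R[i]]_n) : expmx A =
  \matrix_(k, l) ((limn (series (fun j => j`!%:R^-1 * complex.Re ((A ^+ j) k l))))
              +i* (limn (series (fun j => j`!%:R^-1 * complex.Im ((A ^+ j) k l))))).
Proof.
apply: mx_limn; apply: cvg_mx_entries => k l; rewrite mxE.
apply: cvg_complex => /=.
  under eq_fun do rewrite Re_exp_partial.
  apply: (@is_cvg_exp_dominated _ (nrm A) 1) => j.
  by rewrite mul1r Re_entry_expr_le.
under eq_fun do rewrite Im_exp_partial.
apply: (@is_cvg_exp_dominated _ (nrm A) 1) => j.
by rewrite mul1r Im_entry_expr_le.
Qed.

Lemma cvg_exp_partial n (A : 'M[R[i]]_n) k l :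
  (fun N => exp_partial A N k l) @ \oo --> (expmx A k l : R[i]^o).
Proof.
rewrite expmxE mxE; apply: cvg_complex => /=.
  under eq_fun do rewrite Re_exp_partial.
  apply: (@is_cvg_exp_dominated _ (nrm A) 1) => j.
  by rewrite mul1r Re_entry_expr_le.
under eq_fun do rewrite Im_exp_partial.
apply: (@is_cvg_exp_dominated _ (nrm A) 1) => j.
by rewrite mul1r Im_entry_expr_le.
Qed.

Lemma nrm_expmx_le n (A : 'M[R[i]]_n) :
  nrm (expmx A) <= (n * n)%:R * (2 * expR (nrm A)).
Proof.
apply: nrm_le_entries => k l; rewrite (le_trans (normc_le_ReIm _))//.
rewrite expmxE mxE /= mulr_natl mulr2n lerD//; apply: lim_exp_dominated => j.
  exact: Re_entry_expr_le.
exact: Im_entry_expr_le.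
Qed.

Lemma expmx0 n : expmx (0 : 'M[R[i]]_n) = 1%:M.
Proof.
apply: mx_limn; apply: cvg_near_cst; exists 1%N => // -[//|N] _.
rewrite seriesEnat /= big_nat_recl// big1 => [|j _]; last first.
  by rewrite exprS mul0r scaler0.
by rewrite addr0 expr0 fact0 invr1 scale1r.
Qed.

(** Termwise differentiation shifts [A ^+ j] to [A ^+ j.+1]. The resulting partial sums are also the
    entries [U N] of A times those of the exponential, so both expressions have the same limit. *)
Lemma mder_expmx n (A : 'M[R[i]]_n) x :
  mder (fun t => expmx (t%:C *: A)) x (A *m expmx (x%:C *: A)).
Proof.
move=> k l.
have powE (h : nat) t j : ((t%:C *: A) ^+ j) k l = (t ^+ j)%:C * (A ^+ j) k l.
  by rewrite exprZmx mxE rmorphXn.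
pose U N : R[i]^o := \sum_m A k m * exp_partial (x%:C *: A) N m l.
have UE N : U N = (A *m exp_partial (x%:C *: A) N) k l by rewrite mxE.
have cvgU : U @ \oo --> ((A *m expmx (x%:C *: A)) k l : R[i]^o).
  rewrite mxE; apply: cvg_big => [|m _].
    exact: add_continuous.
  by apply: cvgMl_tmp; apply: cvg_exp_partial.
have termE N : U N = \sum_(0 <= j < N) j`!%:R^-1 * ((A ^+ j.+1) k l * (x ^+ j)%:C).
  rewrite UE /exp_partial seriesEnat /= mulmx_sumr summxE; apply: eq_bigr => j _.
  rewrite -scalemxAr mxE exprZmx -scalemxAr mxE; congr (_ * _).
  by rewrite mulrC exprS rmorphXn.
split.
  rewrite (_ : (fun t => _) = fun t => limn (series (fun j => j`!%:R^-1 *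
    (complex.Re ((A ^+ j) k l) * t ^+ j)))); last first.
    apply/funext => t; rewrite expmxE mxE /=; congr (limn (series _)).
    apply/funext => j; rewrite powE//; case: ((A ^+ j) k l) => a b /=.
    by rewrite mul0r subr0 [t ^+ j * _]mulrC.
  rewrite (_ : complex.Re _ = limn (series (fun j => j`!%:R^-1 *
    (complex.Re ((A ^+ j.+1) k l) * x ^+ j)))).
    apply: (@is_derive_exp_dominated (fun j => complex.Re ((A ^+ j) k l)) (nrm A) 1).
      exact: nrm_ge0.
    by move=> j; rewrite mul1r Re_entry_expr_le.
  apply/esym/cvg_lim => //.
  rewrite (_ : series _ = fun N => complex.Re (U N)); first exact: cvg_complex_Re.
  apply/funext => N; rewrite termE seriesEnat raddf_sum; apply: eq_bigr => j _.
  case: ((A ^+ j.+1) k l) => a b.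
  by rewrite -(rmorph_nat (real_complex R)) -fmorphV /= !(mul0r,mulr0,subr0,addr0).
rewrite (_ : (fun t => _) = fun t => limn (series (fun j => j`!%:R^-1 *
  (complex.Im ((A ^+ j) k l) * t ^+ j)))); last first.
  apply/funext => t; rewrite expmxE mxE /=; congr (limn (series _)).
  apply/funext => j; rewrite powE//; case: ((A ^+ j) k l) => a b /=.
  by rewrite mul0r addr0 [t ^+ j * _]mulrC.
rewrite (_ : complex.Im _ = limn (series (fun j => j`!%:R^-1 *
  (complex.Im ((A ^+ j.+1) k l) * x ^+ j)))).
  apply: (@is_derive_exp_dominated (fun j => complex.Im ((A ^+ j) k l)) (nrm A) 1).
    exact: nrm_ge0.
  by move=> j; rewrite mul1r Im_entry_expr_le.
apply/esym/cvg_lim => //.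
rewrite (_ : series _ = fun N => complex.Im (U N)); first exact: cvg_complex_Im.
apply/funext => N; rewrite termE seriesEnat raddf_sum; apply: eq_bigr => j _.
case: ((A ^+ j.+1) k l) => a b.
by rewrite -(rmorph_nat (real_complex R)) -fmorphV /= !(mul0r,mulr0,subr0,addr0,add0r).
Qed.

End MatrixExponential.

(** * Group law, adjoint and perturbation of the exponential *)

Section ExponentialFlow.
Variable R : realType.

(** B commutes with every partial sum, so both sides are limits of the same sequence [U]. *)
Lemma expmx_commute n (A B : 'M[R[i]]_n) :
  A *m B = B *m A -> B *m expmx A = expmx A *m B.
Proof.
move=> AB; apply/matrixP => k l.
have powE j : B *m A ^+ j = A ^+ j *m B.
  elim: j => [|j IH]; first by rewrite expr0 [RHS]mul1mx mulmx1.
  rewrite exprS; change (B *m (A *m A ^+ j) = A *m A ^+ j *m B).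
  by rewrite mulmxA -AB -mulmxA IH mulmxA.
have partE N : B *m exp_partial A N = exp_partial A N *m B.
  rewrite /exp_partial seriesEnat /= mulmx_sumr mulmx_suml.
  by apply: eq_bigr => j _; rewrite -scalemxAr -scalemxAl powE.
pose U N : R[i]^o := \sum_m B k m * exp_partial A N m l.
have UE N : U N = \sum_m exp_partial A N k m * B m l.
  by have := congr1 (fun M => fun_of_matrix M k l) (partE N); rewrite !mxE.
have cvgl : U @ \oo --> ((B *m expmx A) k l : R[i]^o).
  rewrite mxE; apply: cvg_big => [|m _]; first exact: add_continuous.
  by apply: cvgMl_tmp; apply: cvg_exp_partial.
have cvgr : U @ \oo --> ((expmx A *m B) k l : R[i]^o).
  rewrite mxE (funext UE : U = _); apply: cvg_big => [|m _].
    exact: add_continuous.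
  by apply: cvgMr_tmp; apply: cvg_exp_partial.
exact: (cvg_unique (@norm_hausdorff _ R[i]^o) cvgl cvgr).
Qed.

(** The integrating factor of F' = A F: the derivative is 0 when F solves this equation. *)
Lemma mder_expmxN_mul n (A : 'M[R[i]]_n) (F : R -> 'M[R[i]]_n) x D :
  mder F x D ->
  mder (fun t => expmx (t%:C *: - A) *m F t) x
       (expmx (x%:C *: - A) *m (D - A *m F x)).
Proof.
move=> FD; apply: mder_eq (mderM (mder_expmx (- A) x) FD) _.
rewrite mulmxBr addrC; congr (_ + _).
by rewrite -mulmxN mulmxN !mulNmx mulmxA (@expmx_commute n (x%:C *: - A) A)//
  -scalemxAl -scalemxAr mulNmx mulmxN.
Qed.

Lemma expmx_scale0 n (A : 'M[R[i]]_n) : expmx ((0 : R)%:C *: A) = 1%:M.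
Proof. by rewrite scale0r expmx0. Qed.

Lemma expmxN n (A : 'M[R[i]]_n) : expmx (- A) *m expmx A = 1%:M.
Proof.
have h x : 0 <= x <= 1 ->
    mder (fun t : R => expmx (t%:C *: - A) *m expmx (t%:C *: A)) x 0.
  move=> _; apply: mder_eq (mder_expmxN_mul A (mder_expmx A x)) _.
  by rewrite subrr mulmx0.
have := mder0_constant ler01 h.
by rewrite !scale0r !expmx0 mulmx1 !scale1r.
Qed.

Lemma expmxNr n (A : 'M[R[i]]_n) : expmx A *m expmx (- A) = 1%:M.
Proof. by rewrite -{1}[A]opprK expmxN. Qed.

(** As functions of t, both sides solve F' = A F with the same value at 0; the integrating factor
    turns this into constancy on [0, t]. *)
Lemma expmxD n (A : 'M[R[i]]_n) (s t : R) : 0 <= t ->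
  expmx ((t + s)%:C *: A) = expmx (t%:C *: A) *m expmx (s%:C *: A).
Proof.
move=> t0.
have h x : 0 <= x <= t ->
    mder (fun x : R => expmx (x%:C *: - A) *m expmx ((x + s)%:C *: A)) x 0.
  move=> _; apply: mder_eq (mder_expmxN_mul A _) _.
    by apply: (@mder_shift _ _ _ (fun x => expmx (x%:C *: A))); apply: mder_expmx.
  by rewrite subrr mulmx0.
have := mder0_constant t0 h.
rewrite scale0r expmx0 mul1mx add0r => <-.
by rewrite mulmxA scalerN expmxNr mul1mx.
Qed.

Lemma expmx_adj n (A : 'M[R[i]]_n) : (expmx A)^t* = expmx (A^t*).
Proof.
have powE j : (A^t*) ^+ j = (A ^+ j)^t*.
  elim: j => [|j IH]; first by rewrite !expr0 [RHS]adj1.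
  rewrite exprS IH exprSr.
  by change (A^t* *m (A ^+ j)^t* = (A ^+ j *m A)^t*); rewrite adjM.
have adjE (B : 'M[R[i]]_n) k l : (B^t*) k l = Num.conj (B l k) by rewrite !mxE.
apply/matrixP => k l; rewrite adjE.
have limRe (B : 'M[R[i]]_n) p q : complex.Re (expmx B p q) =
    limn (series (fun j => j`!%:R^-1 * complex.Re ((B ^+ j) p q))).
  by rewrite expmxE mxE.
have limIm (B : 'M[R[i]]_n) p q : complex.Im (expmx B p q) =
    limn (series (fun j => j`!%:R^-1 * complex.Im ((B ^+ j) p q))).
  by rewrite expmxE mxE.
have ReJ (z : R[i]) : complex.Re (Num.conj z) = complex.Re z by case: z.
have ImJ (z : R[i]) : complex.Im (Num.conj z) = - complex.Im z by case: z.
apply/eqP; rewrite eq_complex ReJ ImJ !limRe !limIm; apply/andP; split; apply/eqP.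
  congr (limn (series _)); apply/funext => j.
  by rewrite powE adjE ReJ.
rewrite -lim_seriesN; last first.
  apply: (@is_cvg_exp_dominated _ _ (nrm A) 1) => j.
  by rewrite mul1r Im_entry_expr_le.
congr (limn (series _)); apply/funext => j.
by rewrite powE adjE ImJ fctE mulrN.
Qed.

(** Duhamel's argument: [F t = e^(-tB) e^(tA)] has derivative [e^(-tB) (A - B) e^(tA)], and the
    difference of the exponentials is [e^(xB) (F x - F 0)]. The constant L combines the bound C for
    the prefactor with the mean value bound on [0, M]. *)
Lemma expmx_perturbation n (M K : R) : 0 <= M -> exists2 L : R, 0 <= L &
  forall (A B : 'M[R[i]]_n) (x : R), nrm A <= K -> nrm B <= K -> 0 <= x <= M ->
  nrm (expmx (x%:C *: A) - expmx (x%:C *: B)) <= L * nrm (A - B).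
Proof.
move=> M0; pose C : R := (n * n)%:R * (2 * expR (M * K)).
have C0 : 0 <= C by rewrite mulr_ge0// mulr_ge0// expR_ge0.
have expC (A : 'M[R[i]]_n) x : nrm A <= K -> 0 <= x <= M ->
    nrm (expmx (x%:C *: A)) <= C.
  move=> AK /andP[x0 xM]; rewrite (le_trans (nrm_expmx_le _))//.
  rewrite ler_wpM2l// ler_wpM2l// ler_expR nrmZ normc_real ger0_norm//.
  by rewrite ler_pM// nrm_ge0.
exists (C * ((n * n)%:R * (2 * (C * C) * M))).
  by rewrite !mulr_ge0.
move=> A B x AK BK /andP[x0 xM].
pose F t := expmx (t%:C *: - B) *m expmx (t%:C *: A).
have FD t : mder F t (expmx (t%:C *: - B) *m ((A - B) *m expmx (t%:C *: A))).
  by apply: mder_eq (mder_expmxN_mul B (mder_expmx A t)) _; rewrite mulmxBl.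
have -> : expmx (x%:C *: A) - expmx (x%:C *: B) =
    expmx (x%:C *: B) *m (F x - F 0).
  have -> : F 0 = 1%:M by rewrite /F !expmx_scale0 mul1mx.
  by rewrite /F mulmxBr [X in _ = _ - X]mulmx1 mulmxA scalerN expmxNr mul1mx.
have xM' : 0 <= x <= M by rewrite x0 xM.
apply: le_trans (nrmM _ _) _.
rewrite -mulrA ler_pM ?nrm_ge0 ?expC//.
apply: (le_trans (@mder_bound _ _ _ F _ 0 x (C * C * nrm (A - B)) x0 _ _)).
- by move=> t _; apply: FD.
- move=> t /andP[t0 tx]; have tM : 0 <= t <= M by rewrite t0 (le_trans tx).
  apply: le_trans (nrmM _ _) _; rewrite -mulrA ler_pM ?nrm_ge0 ?expC ?nrmN//.
  apply: le_trans (nrmM _ _) _; rewrite mulrC ler_wpM2r ?nrm_ge0 ?expC//.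
rewrite subr0 [leRHS](_ : _ = (n * n)%:R * (2 * (C * C * nrm (A - B)) * M));
  last by ring.
by rewrite ler_wpM2l// ler_wpM2l// !mulr_ge0// nrm_ge0.
Qed.

End ExponentialFlow.

(** * Integrals as differentiable primitives *)

Section Primitive.
Variable R : realType.

(** The integral from 0 to x is constantly 0 for x < 0, so it may fail to be differentiable at 0.
    Integrating from -1 and subtracting the value at 0 gives a function with a two-sided derivative
    there. *)
Lemma Rintegral_primitive (f : R -> R) : continuous f -> exists g : R -> R,
  (forall x : R, -1 < x -> is_derive x 1 g (f x)) /\
  (forall x : R, 0 <= x -> (\int[lebesgue_measure]_(t in `[0, x]) f t)%R = g x).
Proof.
move=> cf; pose I (x : R) : R := (\int[lebesgue_measure]_(t in `[-1, x]) f t)%R.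
have int a b : lebesgue_measure.-integrable `[a, b] (EFin \o f).
  apply: continuous_compact_integrable; first exact: segment_compact.
  exact: continuous_subspaceT.
exists (fun x => I x - I 0); split=> [x x1|x x0].
  have [dI <-] : derivable I x 1 /\ derive1 I x = f x.
    apply: (@continuous_FTC1_closed _ f (-1) x (x + 1)) => //.
      by rewrite ltrDl.
    exact: cf.
  have := is_deriveB (derivableP dI) (is_derive_cst (I 0) x 1).
  by rewrite subr0 -derive1E.
rewrite -Rintegral_itv_obnd_cbnd; last first.
  by apply: integrableS (int 0 x) => //; apply: subset_itvr; rewrite bnd_simp.
rewrite -(@Rintegral_itvB R f (BLeft (-1)) (BRight x) 0) ?bnd_simp//.
Qed.

Lemma mxintegral_primitive m n (F D : R -> 'M[R[i]]_(m, n)) :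
  (forall x, mder F x (D x)) -> exists G : R -> 'M[R[i]]_(m, n),
  (forall x : R, -1 < x -> mder G x (F x)) /\
  (forall x : R, 0 <= x -> mxintegral 0 x F = G x).
Proof.
move=> FD.
have der_cont (f d : R -> R) : (forall x : R, is_derive x 1 f (d x)) -> continuous f.
  move=> fd x; have [dfx _] := fd x.
  exact/differentiable_continuous/derivable1_diffP.
have /choice[gr grP] : forall kl : 'I_m * 'I_n, exists g : R -> R,
    (forall x : R, -1 < x -> is_derive x 1 g (complex.Re (F x kl.1 kl.2))) /\
    (forall x : R, 0 <= x -> (\int[lebesgue_measure]_(t in `[0, x])
       complex.Re (F t kl.1 kl.2))%R = g x).
  move=> kl; apply: Rintegral_primitive.
  by apply: (@der_cont _ (fun x => complex.Re (D x kl.1 kl.2))) => x;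
    have [] := FD x kl.1 kl.2.
have /choice[gi giP] : forall kl : 'I_m * 'I_n, exists g : R -> R,
    (forall x : R, -1 < x -> is_derive x 1 g (complex.Im (F x kl.1 kl.2))) /\
    (forall x : R, 0 <= x -> (\int[lebesgue_measure]_(t in `[0, x])
       complex.Im (F t kl.1 kl.2))%R = g x).
  move=> kl; apply: Rintegral_primitive.
  by apply: (@der_cont _ (fun x => complex.Im (D x kl.1 kl.2))) => x;
    have [] := FD x kl.1 kl.2.
exists (fun x => \matrix_(k, l) ((gr (k, l) x) +i* (gi (k, l) x))).
split=> [x x1 k l|x x0].
  split.
    rewrite (_ : (fun t => _) = gr (k, l)); first exact: (grP (k, l)).1.
    by apply/funext => t; rewrite mxE.
  rewrite (_ : (fun t => _) = gi (k, l)); first exact: (giP (k, l)).1.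
  by apply/funext => t; rewrite mxE.
apply/matrixP => k l; rewrite !mxE.
by rewrite ((grP (k, l)).2 x x0) ((giP (k, l)).2 x x0).
Qed.

End Primitive.

(** * Positive semidefinite forms *)

Section PositiveForms.
Variable C : numClosedFieldType.

Lemma adjB_id n (M N : 'M[C]_n) :
  M^t* = M -> N^t* = N -> (M - N)^t* = M - N.
Proof. by move=> Mh Nh; rewrite adjB Mh Nh. Qed.

(** Row vectors are used to match the conventions of [eigenvalue] and [kermx]. *)
Definition hform n (M : 'M[C]_n) (f : 'rV[C]_n) : C := (f *m M *m f^t*) 0 0.

(** In the order of C, [0 <= z] includes that z is real. *)
Definition psdmx n (M : 'M[C]_n) : Prop := forall f : 'rV[C]_n, 0 <= hform M f.

Definition pdmx n (M : 'M[C]_n) : Prop :=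
  forall f : 'rV[C]_n, f != 0 -> 0 < hform M f.

Lemma hformD n (M N : 'M[C]_n) f : hform (M + N) f = hform M f + hform N f.
Proof. by rewrite /hform mulmxDr mulmxDl mxE. Qed.

Lemma hformZ n c (M : 'M[C]_n) f : hform (c *: M) f = c * hform M f.
Proof. by rewrite /hform -scalemxAr -scalemxAl mxE. Qed.

Lemma hformB n (M N : 'M[C]_n) f : hform (M - N) f = hform M f - hform N f.
Proof. by rewrite -scaleN1r hformD hformZ mulN1r. Qed.

Lemma hform_congr m n (X : 'M[C]_(m, n)) (M : 'M[C]_n) f :
  hform (X *m M *m X^t*) f = hform M (f *m X).
Proof. by rewrite /hform adjM !mulmxA. Qed.

Lemma hform1 n (f : 'rV[C]_n) : hform 1%:M f = \sum_k `|f 0 k| ^+ 2.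
Proof.
rewrite /hform mulmx1 mxE; apply: eq_bigr => k _.
by rewrite !mxE normCK.
Qed.

Lemma hform_delta n (M : 'M[C]_n) k : hform M (delta_mx 0 k) = M k k.
Proof.
rewrite /hform -rowE mxE (bigD1 k)//= big1 ?addr0 => [|l lk].
  by rewrite !mxE !eqxx rmorph1 mulr1.
by rewrite !mxE eqxx (negbTE lk) rmorph0 mulr0.
Qed.

Lemma psdmxD n (M N : 'M[C]_n) : psdmx M -> psdmx N -> psdmx (M + N).
Proof. by move=> M0 N0 f; rewrite hformD addr_ge0. Qed.

Lemma psdmxZ n c (M : 'M[C]_n) : 0 <= c -> psdmx M -> psdmx (c *: M).
Proof. by move=> c0 M0 f; rewrite hformZ mulr_ge0. Qed.

Lemma psdmx_congr m n (X : 'M[C]_(m, n)) (M : 'M[C]_n) :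
  psdmx M -> psdmx (X *m M *m X^t*).
Proof. by move=> M0 f; rewrite hform_congr. Qed.

Lemma psdmx_congr_adj m n (X : 'M[C]_(n, m)) (M : 'M[C]_n) :
  psdmx M -> psdmx (X^t* *m M *m X).
Proof. by move=> /(psdmx_congr (X^t*)); rewrite trmxCK. Qed.

Lemma mulmx_adj_entry m n p (X : 'M[C]_(n, m)) (M : 'M[C]_n) (Z : 'M[C]_(n, p)) k l :
  (X^t* *m M *m Z) k l = (row k (X^t*) *m M *m (row l (Z^t*))^t*) 0 0.
Proof.
have -> : (row l (Z^t*))^t* = col l Z by apply/matrixP => i j; rewrite !mxE conjCK.
by rewrite -row_mul !mxE; apply: eq_bigr => j _; rewrite !mxE.
Qed.

Lemma hform_row_adj m n (X : 'M[C]_(n, m)) (M : 'M[C]_n) k :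
  hform M (row k (X^t*)) = (X^t* *m M *m X) k k.
Proof. by rewrite mulmx_adj_entry. Qed.

Lemma sandwich_inv n (X Y S : 'M[C]_n) : X *m Y = 1%:M -> Y *m X = 1%:M ->
  X *m S *m X^t* \in unitmx ->
  X^t* *m invmx (X *m S *m X^t*) *m X = invmx S.
Proof.
move=> XY YX XSu; have [Xu Yu] := mulmx1_unit XY.
have Xau : X^t* \in unitmx.
  have : Y^t* *m X^t* = 1%:M by rewrite -adjM XY adj1.
  by move=> /mulmx1_unit[].
have Su : S \in unitmx by move: XSu; rewrite !unitmx_mul => /andP[/andP[]].
have SQ : S *m (X^t* *m invmx (X *m S *m X^t*) *m X) = 1%:M.
  apply: (can_inj (mulKmx Xu)); apply: (can_inj (mulmxK Yu)).
  by rewrite mulmx1 XY !mulmxA mulmxV// mul1mx XY.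
by rewrite -(mulKmx Su (_ *m X)) SQ mulmx1.
Qed.

Lemma psdmx1 n : psdmx (1%:M : 'M[C]_n).
Proof. by move=> f; rewrite hform1 sumr_ge0// => k _; rewrite exprn_ge0. Qed.

Lemma psdmx_gram m n (X : 'M[C]_(m, n)) : psdmx (X *m X^t*).
Proof. by rewrite -[X in X *m _]mulmx1; apply/psdmx_congr/psdmx1. Qed.

Lemma pdmx1 n : pdmx (1%:M : 'M[C]_n).
Proof.
move=> f f0; rewrite lt0r psdmx1 andbT; apply: contra f0.
rewrite hform1 psumr_eq0 => [/allP f0|k _]; last by rewrite exprn_ge0.
apply/eqP/rowP => k; have := f0 k (mem_index_enum _).
by rewrite expf_eq0/= normr_eq0 mxE => /eqP.
Qed.

Lemma pdmxW n (M : 'M[C]_n) : pdmx M -> psdmx M.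
Proof.
move=> M0 f; have [->|/M0/ltW//] := eqVneq f 0.
by rewrite /hform !mul0mx mxE.
Qed.

Lemma pdmx_le n (M P : 'M[C]_n) : pdmx P -> psdmx (M - P) -> pdmx M.
Proof.
move=> P0 MP f f0; rewrite (lt_le_trans (P0 f f0))// -subr_ge0 -hformB.
exact: MP.
Qed.

Lemma pdmxZ n c (M : 'M[C]_n) : 0 < c -> pdmx M -> pdmx (c *: M).
Proof. by move=> c0 M0 f f0; rewrite hformZ mulr_gt0// M0. Qed.

Lemma pdmx_unit n (M : 'M[C]_n) : pdmx M -> M \in unitmx.
Proof.
move=> M0; rewrite -row_free_unit -kermx_eq0; apply/eqP/row_matrixP => k.
rewrite row0; apply/eqP; apply: contraT => /M0.
by rewrite /hform -row_mul mulmx_ker row0 mul0mx mxE ltxx.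
Qed.

Lemma psdmx_inv n (M : 'M[C]_n) : M^t* = M -> M \in unitmx ->
  psdmx M -> psdmx (invmx M).
Proof.
move=> Mh Mu M0; rewrite -[X in psdmx X](_ : invmx M *m M *m (invmx M)^t* = _).
  exact: psdmx_congr.
by rewrite mulVmx// mul1mx adjV Mh.
Qed.

(** By the identity P^-1 - M^-1 = (M^-1 - P^-1) P (M^-1 - P^-1) + M^-1 (M - P) M^-1, a sum of two
    congruences of positive semidefinite matrices. *)
Lemma psdmx_inv_antitone n (M P : 'M[C]_n) : M^t* = M -> P^t* = P ->
  pdmx P -> psdmx (M - P) -> psdmx (invmx P - invmx M).
Proof.
move=> Mh Ph P0 MP; have Mu := pdmx_unit (pdmx_le P0 MP).
have Pu := pdmx_unit P0.
rewrite -[X in psdmx X](_ : (invmx M - invmx P) *m P *m (invmx M - invmx P)^t* +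
  invmx M *m (M - P) *m (invmx M)^t* = _).
  by apply: psdmxD; apply: psdmx_congr => //; apply: pdmxW.
rewrite adjB !adjV Mh Ph !(mulmxBl, mulmxBr) (mulVmx Pu) (mulVmx Mu) !mul1mx.
rewrite -(mulmxA (invmx M) P (invmx P)) (mulmxV Pu) mulmx1.
by rewrite addrC addrA -[_ - invmx M in X in _ + X - _]opprB subrr sub0r opprB.
Qed.

Lemma psdmx_tr_ge0 n (M : 'M[C]_n) : psdmx M -> 0 <= \tr M.
Proof. by move=> M0; apply: sumr_ge0 => k _; rewrite -hform_delta. Qed.

Lemma psdmx_diag_le_tr n (M : 'M[C]_n) k : psdmx M -> M k k <= \tr M.
Proof.
move=> M0; rewrite /mxtrace (bigD1 k)//= lerDl sumr_ge0// => l _.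
by rewrite -hform_delta.
Qed.

Lemma hform_real n (M : 'M[C]_n) f : M^t* = M -> hform M f \is Num.real.
Proof.
move=> Mh; apply/CrealP; rewrite /hform -[X in Num.conj X]trace_mx11.
set A := f *m M *m f^t*.
have AA : A^t* = A by rewrite /A !adjM trmxCK Mh mulmxA.
by rewrite trace_mx11 -[in RHS]AA !mxE.
Qed.

(** Expand the form of W at [s *: b - t], which is nonnegative, and divide by s. *)
Lemma hform_amgm n (W : 'M[C]_n) (b t : 'rV[C]_n) (s : C) :
  W^t* = W -> psdmx W -> 0 < s ->
  (b *m W *m t^t*) 0 0 + Num.conj ((b *m W *m t^t*) 0 0) <=
  s * hform W b + s^-1 * hform W t.
Proof.
set z := (_ *m _) 0 0; move=> Wh W0 s0.
have sr : Num.conj s = s by apply/CrealP/gtr0_real.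
have zE : Num.conj z = (t *m W *m b^t*) 0 0.
  have : (b *m W *m t^t*)^t* = t *m W *m b^t* by rewrite !adjM trmxCK Wh mulmxA.
  by move=> <-; rewrite /z !mxE.
have := W0 (s *: b - t).
have -> : hform W (s *: b - t) =
    s * (s * hform W b + s^-1 * hform W t - (z + Num.conj z)).
  rewrite zE /hform /z adjB adjZ sr !(mulmxBl, mulmxBr) -!scalemxAl -!scalemxAr.
  rewrite !mxE; rewrite !mulrBr !mulrDr [s * (s^-1 * _)]mulrA divff ?gt_eqF// mul1r.
  by rewrite opprB !opprD; ring.
by rewrite pmulr_rge0// subr_ge0.
Qed.

(** Each product of moduli of two coordinates of f is at most the square of the larger one, hence at
    most the squared norm of f. *)
Lemma hform_le_sum n (M : 'M[C]_n) : M^t* = M ->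
  psdmx ((\sum_k \sum_l `|M k l|)%:M - M).
Proof.
move=> Mh f; rewrite hformB -scalemx1 hformZ subr_ge0.
apply: le_trans (real_ler_norm (hform_real _ Mh)) _.
have fle k l : `|f 0 k| * `|f 0 l| <= hform 1%:M f.
  have [kl|lk] := real_leP (normr_real (f 0 k)) (normr_real (f 0 l)).
    apply: (@le_trans _ _ (`|f 0 l| ^+ 2)); first by rewrite expr2 ler_wpM2r.
    by rewrite hform1 (bigD1 l)//= lerDl sumr_ge0// => ? _; rewrite exprn_ge0.
  apply: (@le_trans _ _ (`|f 0 k| ^+ 2)); first by rewrite expr2 ler_wpM2l// ltW.
  by rewrite hform1 (bigD1 k)//= lerDl sumr_ge0// => ? _; rewrite exprn_ge0.
rewrite [hform M f]mxE (le_trans (ler_norm_sum _ _ _))//.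
rewrite exchange_big mulr_suml; apply: ler_sum => l _.
rewrite normrM mxE mulr_suml (le_trans (ler_wpM2r _ (ler_norm_sum _ _ _)))//.
rewrite mulr_suml; apply: ler_sum => k _.
rewrite normrM (_ : f^t* l 0 = Num.conj (f 0 l)); last by rewrite !mxE.
by rewrite norm_conjC mulrAC [leRHS]mulrC ler_wpM2r// fle.
Qed.

Lemma eigenvalue_gt0_coercive n (M : 'M[C]_n) : M \is hermsymmx ->
  (forall a, eigenvalue M a -> 0 < a) ->
  exists2 c : C, 0 < c & psdmx (M - c%:M).
Proof.
move=> Mh Me; have /hermitian_normalmx/orthomx_spectralP := Mh.
set P := spectralmx M; set d := spectral_diag M => MPd.
have Pu : P \in unitmx by apply: spectral_unit.
have PV : invmx P = P^t* by rewrite invmx_unitary ?spectral_unitarymx.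
have d0 k : 0 < d 0 k.
  apply: Me; apply/eigenvalueP; exists (row k P).
    rewrite -row_mul {1}MPd !mulmxA mulmxV// mul1mx mul_diag_mx.
    by apply/rowP => l; rewrite !mxE.
  have : row_free P by rewrite row_free_unit.
  move=> /row_freeP[Q PQ]; apply/eqP => Pk.
  have := congr1 (row k) PQ; rewrite row_mul Pk mul0mx => /rowP/(_ k)/eqP.
  by rewrite !mxE eqxx eq_sym oner_eq0.
(* This lies below every eigenvalue, since [(d 0 k)^-1] is a term of the sum. The summand 1 keeps c
   positive when n = 0. *)
pose c := (1 + \sum_k (d 0 k)^-1)^-1.
have S0 : 0 <= \sum_k (d 0 k)^-1 by apply: sumr_ge0 => k _; rewrite invr_ge0 ltW.
have c0 : 0 < c by rewrite invr_gt0 ltr_pwDl.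
exists c => //; rewrite {1}MPd PV -[X in psdmx X](_ :
  P^t* *m (diag_mx d - c%:M) *m (P^t*)^t* = _).
  apply: psdmx_congr => f; rewrite /hform mxE; apply: sumr_ge0 => k _.
  rewrite -diag_const_mx -raddfB mul_mx_diag !mxE mulrAC mulr_ge0//.
    by rewrite -normCK exprn_ge0.
  rewrite subr_ge0 -[leRHS]invrK lef_pV2 ?posrE ?invr_gt0 ?ltr_pwDl//.
  rewrite (bigD1 k)//= addrCA lerDl addr_ge0// sumr_ge0// => l _.
  by rewrite invr_ge0 ltW.
rewrite trmxCK mulmxBr mulmxBl; congr (_ - _).
by rewrite mul_mx_scalar -scalemxAl -PV mulVmx// scalemx1.
Qed.

Lemma pdmx_eigenvalue_gt0 n (M : 'M[C]_n) a : pdmx M -> eigenvalue M a -> 0 < a.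
Proof.
move=> M0 /eigenvalueP[f fM f0]; have := M0 f f0.
rewrite /hform fM -scalemxAl mxE; have := @pdmx1 n f f0.
by rewrite /hform mulmx1 => f1; rewrite pmulr_lgt0.
Qed.

(** Meant for M >= c and M - N <= r <= e: each of the three terms on the right is then positive
    semidefinite. *)
Lemma coercive_split n (M N : 'M[C]_n) (c e r : C) :
  N - (c - e) *: 1%:M = (M - c *: 1%:M) +
    ((r *: 1%:M - (M - N)) + (e - r) *: 1%:M).
Proof. by apply/matrixP => k l; rewrite !mxE; ring. Qed.

End PositiveForms.

(** * Quantitative positivity over [R[i]] *)

Section ComplexForms.
Variable R : realType.

Lemma conjcE (z : R[i]) : z + Num.conj z = (2 * complex.Re z)%:C.
Proof.
by case: z => a b; apply/eqP; rewrite eq_complex /= subrr mulr_natl mulr2n !eqxx.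
Qed.

Lemma ge0_ReE (z : R[i]) : 0 <= z -> z = (complex.Re z)%:C.
Proof. by case: z => a b; rewrite lecE /= => /andP[/eqP->]. Qed.

Lemma ge0_Re_ge0 (z : R[i]) : 0 <= z -> 0 <= complex.Re z.
Proof. by rewrite lecE => /andP[]. Qed.

(** Multiplying t by a number c of modulus 1 leaves the right side unchanged and turns the real part
    of z into that of z times the conjugate of c. The choices 1, -1, i, -i bound both the real and
    the imaginary part of z in modulus by half of the right side. *)
Lemma psdmx_hform_amgm n (W : 'M[R[i]]_n) (b t : 'rV[R[i]]_n) (s : R) :
  W^t* = W -> psdmx W -> 0 < s ->
  Normc.normc ((b *m W *m t^t*) 0 0) <=
    s * complex.Re (hform W b) + s^-1 * complex.Re (hform W t).
Proof.
move=> Wh W0 s0; set z := (_ *m _) 0 0.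
have sC : 0 < s%:C by rewrite ltcR.
have bound (c : R[i]) : Num.conj c * c = 1 -> complex.Re (z * Num.conj c) *+ 2 <=
    s * complex.Re (hform W b) + s^-1 * complex.Re (hform W t).
  move=> c1; have := @hform_amgm _ n W b (c *: t) s%:C Wh W0 sC.
  have -> : (b *m W *m (c *: t)^t*) 0 0 = z * Num.conj c.
    by rewrite adjZ -scalemxAr [LHS]mxE mulrC.
  rewrite conjcE.
  have -> : hform W (c *: t) = hform W t.
    by rewrite /hform adjZ -!scalemxAl -scalemxAr scalerA mulrC c1 scale1r.
  rewrite (ge0_ReE (W0 b)) (ge0_ReE (W0 t)) -fmorphV -!rmorphM -rmorphD lecR.
  by rewrite mulr_natl.
rewrite (le_trans (normc_le_ReIm _))//.
have b1 := bound 1; have bN1 := bound (-1).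
have bi := bound 'i%C; have bNi := bound (- 'i%C).
rewrite -(ler_pM2r (ltr0n R 2))mulrDl !mulr_natr [leRHS]mulr2n lerD//.
  have [Rz|Rz] := ger0P (complex.Re z).
    by move: b1; rewrite rmorph1 !mulr1 => /(_ erefl).
  move: bN1; rewrite rmorphN1 mulrNN !mulr1 => /(_ erefl).
  by rewrite mulrN1 raddfN.
have [Iz|Iz] := ger0P (complex.Im z).
  have -> : complex.Im z = complex.Re (z * Num.conj 'i%C).
    by case: (z) => p q /=; rewrite mulr0 mulrN1 sub0r opprK.
  by apply: bi; apply/eqP; rewrite eq_complex /=; apply/andP; split; apply/eqP; ring.
have -> : - complex.Im z = complex.Re (z * Num.conj (- 'i%C)).
  by case: (z) => p q /=; rewrite oppr0 opprK mulr0 mulr1 sub0r.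
by apply: bNi; apply/eqP; rewrite eq_complex /=; apply/andP; split; apply/eqP; ring.
Qed.

Lemma posdefmx_coercive n (M : 'M[R[i]]_n) : posdefmx M ->
  exists2 c : R, 0 < c & psdmx (M - c%:C *: 1%:M).
Proof.
move=> [Mh Me]; have [c c0 Mc] := eigenvalue_gt0_coercive Mh Me.
exists (complex.Re c); last by rewrite -ge0_ReE ?scalemx1// ltW.
by move: c0; rewrite ltcE => /andP[].
Qed.

Lemma posdefmx_adj n (M : 'M[R[i]]_n) : posdefmx M -> M^t* = M.
Proof. by move=> [/is_hermitianmxP]; rewrite expr0 scale1r => <-. Qed.

(** Positivity of the eigenvalues takes the place of a minimum over the unit sphere. *)
Lemma pdmx_coercive n (M : 'M[R[i]]_n) : M^t* = M -> pdmx M ->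
  exists2 c : R, 0 < c & psdmx (M - c%:C *: 1%:M).
Proof.
move=> Mh M0; apply: posdefmx_coercive; split.
  by apply/is_hermitianmxP; rewrite expr0 scale1r.
by move=> a; apply: pdmx_eigenvalue_gt0.
Qed.

Lemma scalemx1_pd n (c : R) : 0 < c -> pdmx (c%:C *: 1%:M : 'M[R[i]]_n).
Proof. by move=> c0; apply: pdmxZ; rewrite ?ltcR//; apply: pdmx1. Qed.

Lemma scalemx1_adj n (c : R) : (c%:C *: 1%:M : 'M[R[i]]_n)^t* = c%:C *: 1%:M.
Proof. by rewrite adjZ adj1; congr (_ *: _); apply: conjc_real. Qed.

Lemma invmx_scale1 n (c : R) : 0 < c ->
  invmx (c%:C *: 1%:M : 'M[R[i]]_n) = (c^-1)%:C *: 1%:M.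
Proof.
move=> c0; rewrite invmxZ ?invmx1 ?fmorphV//.
by rewrite scalemx1; apply: pdmx_unit; rewrite -scalemx1; apply: scalemx1_pd.
Qed.

Lemma psdmx_le_nrm n (M : 'M[R[i]]_n) : M^t* = M ->
  psdmx ((nrm M)%:C *: 1%:M - M).
Proof.
have nrmE : (nrm M)%:C = \sum_k \sum_l `|M k l|.
  rewrite /nrm rmorph_sum /=; apply: eq_bigr => k _.
  by rewrite rmorph_sum /=; apply: eq_bigr => l _; rewrite normr_normc.
by move=> Mh; rewrite nrmE scalemx1; apply: hform_le_sum.
Qed.

Lemma coercive_perturbation n (M N : 'M[R[i]]_n) (c e : R) :
  M^t* = M -> N^t* = N -> nrm (N - M) <= e ->
  psdmx (M - c%:C *: 1%:M) -> psdmx (N - (c - e)%:C *: 1%:M).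
Proof.
move=> Mh Nh MNe Mc.
rewrite rmorphB (coercive_split M N c%:C e%:C (nrm (M - N))%:C) -rmorphB.
apply: psdmxD; first exact: Mc.
apply: psdmxD; first by apply: psdmx_le_nrm; rewrite adjB Mh Nh.
by apply: psdmxZ; [rewrite lecR subr_ge0 nrmB|apply: psdmx1].
Qed.

(** By antitonicity of the inverse, the diagonal entries of W = M^-1 are at most 1/c. The inequality
    with weight 1 at two basis vectors bounds the entry (k, l) by W_kk + W_ll, hence by 2/c. *)
Lemma nrm_invmx_coercive n (M : 'M[R[i]]_n) (c : R) : 0 < c -> M^t* = M ->
  psdmx (M - c%:C *: 1%:M) ->
  M \in unitmx /\ nrm (invmx M) <= (n * n)%:R * (2 * c^-1).
Proof.
move=> c0 Mh Mc; have M0 : pdmx M := pdmx_le (@scalemx1_pd n c c0) Mc.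
have Mu := pdmx_unit M0; split=> //.
have Wh : (invmx M)^t* = invmx M by rewrite adjV Mh.
have W0 : psdmx (invmx M) by apply: psdmx_inv Mh Mu (pdmxW M0).
have diagW k : complex.Re (hform (invmx M) (delta_mx 0 k)) <= c^-1.
  have := psdmx_inv_antitone Mh (scalemx1_adj n c) (@scalemx1_pd n c c0) Mc.
  move=> /(_ (delta_mx 0 k)); rewrite invmx_scale1// hformB subr_ge0 hformZ.
  by rewrite (hform_delta 1%:M) mxE eqxx mulr1 lecE => /andP[].
apply: nrm_le_entries => k l.
have := psdmx_hform_amgm (delta_mx 0 k) (delta_mx 0 l) Wh W0 ltr01.
rewrite invr1 !mul1r -rowE mxE (bigD1 l)//= big1 ?addr0 => [|j jl].
  rewrite !mxE !eqxx rmorph1 mulr1 => /le_trans; apply.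
  by rewrite mulr_natl mulr2n lerD.
by rewrite !mxE eqxx (negbTE jl) rmorph0 mulr0.
Qed.

Lemma cder_hform n (F : R -> 'M[R[i]]_n) x D (f : 'rV[R[i]]_n) : mder F x D ->
  cder (fun t => hform (F t) f) x (hform D f).
Proof. by move=> FD; apply: (mderMr (f^t*) (mderMl f FD)). Qed.

Lemma psdmx_increment n (F D : R -> 'M[R[i]]_n) (a b : R) : a <= b ->
  (forall x, a <= x <= b -> mder F x (D x)) ->
  (forall x, a <= x <= b -> psdmx (D x)) -> psdmx (F b - F a).
Proof.
move=> ab FD D0 f; rewrite hformB.
have gd x : a <= x <= b -> cder (fun t => hform (F t) f) x (hform (D x) f).
  by move=> xab; apply: cder_hform (FD x xab).
have [|c ca hc] := @MVT_segment_derivable R (fun t => complex.Re (hform (F t) f))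
  (fun x => complex.Re (hform (D x) f)) a b ab.
  by move=> x /gd[].
have [|e ea he] := @MVT_segment_derivable R (fun t => complex.Im (hform (F t) f))
  (fun x => complex.Im (hform (D x) f)) a b ab.
  by move=> x /gd[].
rewrite lecE !raddfB/= hc he mulr_ge0 ?subr_ge0 ?andbT//.
  by rewrite (ge0_ReE (D0 e ea f)) mul0r.
exact: ge0_Re_ge0 (D0 c ca f).
Qed.

End ComplexForms.

(** * The increasing Gram matrix R(x) *)

Section SquaredExponential.
Variables (R : realType) (n : nat).
Implicit Types A : 'M[R[i]]_n.

Lemma expmx_scale_commute A (c : R[i]) :
  expmx (c *: A) *m A = A *m expmx (c *: A).
Proof. by apply/esym/expmx_commute; rewrite -scalemxAl -scalemxAr. Qed.

Lemma expmx_scale_commute2 A (c d : R[i]) :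
  expmx (c *: A) *m expmx (d *: A) = expmx (d *: A) *m expmx (c *: A).
Proof.
apply: (@expmx_commute _ _ (d *: A) (expmx (c *: A))).
by rewrite -(scalemxAl d A) -(scalemxAr d _ A) expmx_scale_commute.
Qed.

Lemma expmx_unit A : expmx A \in unitmx.
Proof. exact: (mulmx1_unit (expmxNr A)).1. Qed.

Lemma mder_expmx_sqr A x :
  mder (fun t : R => expmx (t%:C *: A) *m expmx (t%:C *: A)) x
       (2 *: (A *m (expmx (x%:C *: A) *m expmx (x%:C *: A)))).
Proof.
have h := mderM (mder_expmx A x) (mder_expmx A x); apply: mder_eq h _.
by rewrite [_ *m (A *m _)]mulmxA expmx_scale_commute !mulmxA scaler_nat mulr2n.
Qed.

Lemma expmx_sqrD A (s t : R) : 0 <= t ->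
  let E x := expmx (x%:C *: A) *m expmx (x%:C *: A) in
  E (t + s) = E t *m E s.
Proof.
move=> t0 E; rewrite /E (expmxD A s t0).
have := expmx_scale_commute2 A s%:C t%:C.
move: (expmx (t%:C *: A)) (expmx (s%:C *: A)) => p q qp.
by rewrite -mulmxA (mulmxA q) qp -!mulmxA.
Qed.

End SquaredExponential.

Section GramFlow.
Variables (R : realType) (n m1 m2 : nat).
Variables (alpha S0 : 'M[R[i]]_n).
Variables (theta1 : 'M[R[i]]_(n, m1)) (theta2 : 'M[R[i]]_(n, m2)).

(** This is e^(-2ix alpha), kept as a square so that one factor can cancel against the exponentials
    in the potential. *)
Definition flow (x : R) : 'M[R[i]]_n :=
  expmx (x%:C *: - ('i%C *: alpha)) *m expmx (x%:C *: - ('i%C *: alpha)).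

Definition Bmx (x : R) : 'M[R[i]]_(n, m1) := flow x *m theta1.

(* [e^(- i x alpha) S(x) e^(i x alpha^* )]: it is increasing in [x], and the
   factor [e^(i x alpha)] next to [theta2] in the potential drops out. *)
Definition Rmx (x : R) : 'M[R[i]]_n :=
  expmx (x%:C *: - ('i%C *: alpha)) *m Smx alpha S0 theta1 theta2 x
  *m (expmx (x%:C *: - ('i%C *: alpha)))^t*.

Lemma flow_mder x : mder flow x ((- 2 * 'i%C) *: (alpha *m flow x)).
Proof.
apply: mder_eq (mder_expmx_sqr _ x) _.
by rewrite mulNmx -scalemxAl scalerN scalerA mulNr scaleNr.
Qed.

Lemma flow0 : flow 0 = 1%:M.
Proof. by rewrite /flow expmx_scale0 mulmx1. Qed.

Lemma flowD (s t : R) : 0 <= t -> flow (t + s) = flow t *m flow s.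
Proof. exact: expmx_sqrD. Qed.

Lemma flow_unit x : flow x \in unitmx.
Proof. by rewrite unitmx_mul expmx_unit. Qed.

Lemma flow_commute x : flow x *m alpha = alpha *m flow x.
Proof.
have Xa : expmx (x%:C *: - ('i%C *: alpha)) *m alpha =
          alpha *m expmx (x%:C *: - ('i%C *: alpha)).
  have -> : x%:C *: - ('i%C *: alpha) = (- (x%:C * 'i%C)) *: alpha.
    by rewrite scalerN scalerA scaleNr.
  exact: expmx_scale_commute.
by rewrite -mulmxA Xa !mulmxA Xa.
Qed.

Lemma Bmx_mder x : mder Bmx x ((- 2 * 'i%C) *: (alpha *m Bmx x)).
Proof.
by apply: mder_eq (mderMr theta1 (flow_mder x)) _; rewrite -scalemxAl /Bmx mulmxA.
Qed.

End GramFlow.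

Section FlowAlgebra.
Variable C : numClosedFieldType.

(** The derivative of alpha S - S alpha^* - i Lambda Lambda^* in abstract form: c = i, while a, b
    stand for alpha P1, P1 alpha^* and d, e for alpha P2, P2 alpha^* with Pk = Lk Lk^*. *)
Lemma lyapunov_cancel m n (c : C) (a b d e : 'M[C]_(m, n)) : c * c = -1 ->
  (a - d) - (b - e) - c *: ((- c *: a + c *: b) + (c *: d - c *: e)) = 0.
Proof.
move=> cc; apply/matrixP => k l; rewrite !mxE.
have -> : forall x y z t : C, x - z - (y - t) - c * ((- c * x + c * y) +
    (c * z - c * t)) = (x - z - y + t) * (1 + c * c).
  by move=> x y z t; ring.
by rewrite cc subrr mulr0.
Qed.

(** The left side is the derivative of X S X^* when X' = - A X and S' = I. *)
Lemma sandwich_derivative n (X S I A : 'M[C]_n) :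
  (- A *m X *m S + X *m I) *m X^t* + X *m S *m (- A *m X)^t* =
  X *m I *m X^t* - (A *m (X *m S *m X^t*) - X *m S *m X^t* *m - A^t*).
Proof.
by rewrite mulmxDl !mulNmx adjN adjM !mulmxN opprK !mulmxA opprD addrA
  [X in X - _ = _]addrC.
Qed.

Lemma sandwich_gram n p (X : 'M[C]_n) (L : 'M[C]_(n, p)) :
  X *m (L *m L^t*) *m X^t* = (X *m L) *m (X *m L)^t*.
Proof. by rewrite adjM !mulmxA. Qed.

Lemma sandwich_commutator n (X S A : 'M[C]_n) : X *m A = A *m X ->
  A *m (X *m S *m X^t*) - X *m S *m X^t* *m A^t* =
  X *m (A *m S - S *m A^t*) *m X^t*.
Proof.
move=> XA; rewrite mulmxBr mulmxBl !mulmxA XA; congr (_ - _).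
by rewrite -!mulmxA -!adjM XA.
Qed.

End FlowAlgebra.

(** * The Lyapunov identity and the derivative of R *)

Section GramMatrix.
Variables (R : realType) (n m1 m2 : nat).
Variables (alpha S0 : 'M[R[i]]_n).
Variables (theta1 : 'M[R[i]]_(n, m1)) (theta2 : 'M[R[i]]_(n, m2)).

Lemma mul_row_jmx (a : 'M[R[i]]_(n, m1)) (b : 'M[R[i]]_(n, m2)) :
  row_mx a b *m jmx R m1 m2 *m (row_mx a b)^t* = a *m a^t* - b *m b^t*.
Proof.
rewrite /jmx mul_row_block !mulmx0 mulmx1 mulmxN mulmx1 addr0 add0r.
by rewrite tr_row_mx map_col_mx mul_row_col mulNmx.
Qed.

Lemma mder_gram m p (L : R -> 'M[R[i]]_(m, p)) (A : 'M[R[i]]_m) x :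
  mder L x (A *m L x) ->
  mder (fun t => L t *m (L t)^t*) x
    (A *m (L x *m (L x)^t*) + L x *m (L x)^t* *m A^t*).
Proof.
move=> LA; have h := mderM LA (mder_adj LA); apply: mder_eq h _.
by rewrite adjM !mulmxA.
Qed.

Lemma adj_imul (M : 'M[R[i]]_n) : ('i%C *: M)^t* = - ('i%C *: M^t*).
Proof.
rewrite adjZ -scaleNr; congr (_ *: _); apply/eqP.
by rewrite eq_complex /= oppr0 !eqxx.
Qed.

Lemma expmx_imul (x : R) (M : 'M[R[i]]_n) :
  expmx (('i%C * x%:C) *: M) = expmx (x%:C *: ('i%C *: M)).
Proof. by rewrite scalerA mulrC. Qed.

Lemma expmx_Nimul (x : R) (M : 'M[R[i]]_n) :
  expmx (- ('i%C * x%:C) *: M) = expmx (x%:C *: - ('i%C *: M)).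
Proof. by rewrite scalerN scalerA mulrC scaleNr. Qed.

Lemma expmx_imul_adj (x : R) (M : 'M[R[i]]_n) :
  expmx (('i%C * x%:C) *: M^t*) = (expmx (x%:C *: - ('i%C *: M)))^t*.
Proof.
have xr : Num.conj (x%:C) = x%:C := conjc_real x.
by rewrite expmx_imul expmx_adj adjZ xr adjN adj_imul opprK.
Qed.

Lemma expmx_scaleN (x : R[i]) (M : 'M[R[i]]_n) :
  expmx (x *: - M) *m expmx (x *: M) = 1%:M.
Proof. by rewrite scalerN expmxN. Qed.

Lemma expmx_scaleNr (x : R[i]) (M : 'M[R[i]]_n) :
  expmx (x *: M) *m expmx (x *: - M) = 1%:M.
Proof. by rewrite scalerN expmxNr. Qed.

Hypothesis S0alpha : alpha *m S0 - S0 *m alpha^t* =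
    'i%C *: (theta1 *m theta1^t* + theta2 *m theta2^t*).

Let L1 (x : R) := expmx (x%:C *: - ('i%C *: alpha)) *m theta1.
Let L2 (x : R) := expmx (x%:C *: ('i%C *: alpha)) *m theta2.
Let I (x : R) := L1 x *m (L1 x)^t* - L2 x *m (L2 x)^t*.

Lemma Lambda_jmxE (x : R) :
  Lambda alpha theta1 theta2 x *m jmx R m1 m2 *m (Lambda alpha theta1 theta2 x)^t*
  = I x.
Proof. by rewrite /Lambda mul_row_jmx expmx_imul expmx_Nimul. Qed.

Let mder_L1 x : mder L1 x (- ('i%C *: alpha) *m L1 x).
Proof.
have h := mderMr theta1 (mder_expmx (- ('i%C *: alpha)) x).
by apply: mder_eq h _; rewrite /L1 mulmxA.
Qed.

Let mder_L2 x : mder L2 x (('i%C *: alpha) *m L2 x).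
Proof.
have h := mderMr theta2 (mder_expmx ('i%C *: alpha) x).
by apply: mder_eq h _; rewrite /L2 mulmxA.
Qed.

Let DP1 x := - 'i%C *: (alpha *m (L1 x *m (L1 x)^t*)) +
              'i%C *: (L1 x *m (L1 x)^t* *m alpha^t*).
Let DP2 x := 'i%C *: (alpha *m (L2 x *m (L2 x)^t*)) -
              'i%C *: (L2 x *m (L2 x)^t* *m alpha^t*).

Let mder_P1 x : mder (fun t => L1 t *m (L1 t)^t*) x (DP1 x).
Proof.
apply: mder_eq (mder_gram (mder_L1 x)) _.
by rewrite /DP1 adjN adj_imul opprK mulNmx -scalemxAl -scalemxAr scaleNr.
Qed.

Let mder_P2 x : mder (fun t => L2 t *m (L2 t)^t*) x (DP2 x).
Proof.
apply: mder_eq (mder_gram (mder_L2 x)) _.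
by rewrite /DP2 adj_imul mulmxN -scalemxAl -scalemxAr.
Qed.

(** For x < 0 the integral in [Smx] is over an empty interval, so [Smx] may have a corner at 0. The
    function S agrees with it for x >= 0 and is differentiable at 0 as well. *)
Lemma Smx_primitive : exists S : R -> 'M[R[i]]_n,
  [/\ forall x, 0 <= x -> Smx alpha S0 theta1 theta2 x = S x,
      S 0 = S0 & forall x, 0 <= x -> mder S x (I x)].
Proof.
have [G [Gd GE]] := mxintegral_primitive (fun x => mderB (mder_P1 x) (mder_P2 x)).
exists (fun x => S0 + G x); split.
- move=> x x0; rewrite /Smx -GE//; congr (_ + mxintegral _ _ _).
  by apply/funext => t; apply: Lambda_jmxE.
- rewrite -GE//; apply/matrixP => k l; rewrite !mxE.
  by rewrite set_itv1 !Rintegral_set1 addr0.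
move=> x x0; have h := mderD (mder_cst S0 x) (Gd x (lt_le_trans (ltrN10 R) x0)).
by apply: mder_eq h _; rewrite add0r.
Qed.

Lemma Smx_identity (S : R -> 'M[R[i]]_n) x : S 0 = S0 ->
  (forall x, 0 <= x -> mder S x (I x)) -> 0 <= x ->
  alpha *m S x - S x *m alpha^t* =
    'i%C *: (L1 x *m (L1 x)^t* + L2 x *m (L2 x)^t*).
Proof.
move=> S00 Sd x0.
pose K t := alpha *m S t - S t *m alpha^t* -
  'i%C *: (L1 t *m (L1 t)^t* + L2 t *m (L2 t)^t*).
have Kd t : 0 <= t <= x -> mder K t 0.
  move=> /andP[t0 _].
  have h := mderB (mderB (mderMl alpha (Sd t t0)) (mderMr (alpha^t*) (Sd t t0)))
    (mderZ 'i%C (mderD (mder_P1 t) (mder_P2 t))).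
  apply: mder_eq h _; rewrite /I mulmxBr mulmxBl.
  by apply: lyapunov_cancel; rewrite -expr2 sqr_i.
have /eqP := mder0_constant x0 Kd.
rewrite {2}/K S00 S0alpha /L1 /L2 !expmx_scale0 !mul1mx subrr subr_eq0.
by move=> /eqP.
Qed.

Lemma Rmx_flow : exists G : R -> 'M[R[i]]_n,
  [/\ forall x, 0 <= x -> Rmx alpha S0 theta1 theta2 x = G x,
      G 0 = S0,
      forall x, 0 <= x ->
        mder G x (2 *: (Bmx alpha theta1 x *m (Bmx alpha theta1 x)^t*)) &
      forall x, 0 <= x -> alpha *m G x - G x *m alpha^t* =
        'i%C *: (Bmx alpha theta1 x *m (Bmx alpha theta1 x)^t*
                 + theta2 *m theta2^t*)].
Proof.
have [S [SE S00 Sd]] := Smx_primitive.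
pose X x : 'M[R[i]]_n := expmx (x%:C *: - ('i%C *: alpha)).
pose G x := X x *m S x *m (X x)^t*.
have XL1 x : X x *m L1 x = Bmx alpha theta1 x by rewrite /L1 mulmxA.
have XL2 x : X x *m L2 x = theta2 by rewrite /L2 mulmxA expmx_scaleN mul1mx.
have Xalpha x : X x *m alpha = alpha *m X x.
  have -> : X x = expmx ((- (x%:C * 'i%C)) *: alpha).
    by rewrite /X scalerN scalerA scaleNr.
  exact: expmx_scale_commute.
have Galpha x : 0 <= x -> alpha *m G x - G x *m alpha^t* =
    'i%C *: (Bmx alpha theta1 x *m (Bmx alpha theta1 x)^t* + theta2 *m theta2^t*).
  move=> x0; have -> := sandwich_commutator (S x) (Xalpha x).
  rewrite (Smx_identity S00 Sd x0) -(scalemxAr 'i%C (X x)) -(scalemxAl 'i%C).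
  by rewrite mulmxDr mulmxDl !sandwich_gram XL1 XL2.
exists G; split => //.
- by move=> x x0; rewrite /Rmx SE.
- by rewrite /G /X expmx_scale0 S00 adj1 mul1mx mulmx1.
move=> x x0.
have h := mderM (mderM (mder_expmx (- ('i%C *: alpha)) x) (Sd x x0))
  (mder_adj (mder_expmx (- ('i%C *: alpha)) x)).
apply: mder_eq h _; rewrite -/(X x) sandwich_derivative -/(G x).
(* The Lyapunov identity turns the commutator term into B B^* + theta2 theta2^*, while X I X^* is B
   B^* - theta2 theta2^*; the theta2 parts cancel and 2 B B^* remains. *)
rewrite adj_imul opprK -scalemxAl -scalemxAr -scalerBr Galpha// scalerA.
rewrite -expr2 sqr_i scaleN1r opprK /I mulmxBr mulmxBl !sandwich_gram XL1 XL2.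
by rewrite addrACA [- _ + _]addrC subrr addr0 scaler_nat mulr2n.
Qed.

End GramMatrix.

(** * Bounds for the potential *)

Section PotentialBounds.
Variables (R : realType) (n m1 m2 : nat).
Variables (alpha S0 : 'M[R[i]]_n).
Variables (theta1 : 'M[R[i]]_(n, m1)) (theta2 : 'M[R[i]]_(n, m2)).
Hypothesis adm : admissible alpha S0 theta1 theta2.

Local Notation B := (Bmx alpha theta1).
Local Notation Rm := (Rmx alpha S0 theta1 theta2).

Let S0h : S0^t* = S0 := posdefmx_adj adm.1.
Let RmF := Rmx_flow adm.2.

Lemma Rmx0 : Rm 0 = S0.
Proof. by have [G [GE G0 _ _]] := RmF; rewrite GE. Qed.

Lemma Rmx_lyapunov x : 0 <= x -> alpha *m Rm x - Rm x *m alpha^t* =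
  'i%C *: (B x *m (B x)^t* + theta2 *m theta2^t*).
Proof. by have [G [GE _ _ Ga]] := RmF => x0; rewrite GE// Ga. Qed.

Lemma Rmx_increasing x y : 0 <= x <= y -> psdmx (Rm y - Rm x).
Proof.
have [G [GE _ Gd _]] := RmF => /andP[x0 xy].
rewrite (GE x x0) (GE y (le_trans x0 xy)).
apply: (psdmx_increment xy) => t /andP[xt _].
  exact: Gd (le_trans x0 xt).
apply: psdmxZ; first exact: ler0n.
exact: psdmx_gram.
Qed.

Lemma Rmx_adj x : 0 <= x -> (Rm x)^t* = Rm x.
Proof.
have [G [GE G0 Gd _]] := RmF => x0; rewrite GE//.
have h t : 0 <= t <= x -> mder (fun t => (G t)^t* - G t) t 0.
  move=> /andP[t0 _]; have h := mderB (mder_adj (Gd t t0)) (Gd t t0).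
  by apply: mder_eq h _; rewrite adjZ adjM trmxCK rmorph_nat subrr.
have /eqP := mder0_constant x0 h.
by rewrite G0 S0h subrr subr_eq0 => /eqP.
Qed.

(** The lower bound c is independent of x, so a bound for S0 alone controls the inverses of all
    R(x). *)
Lemma Rmx_coercive (c : R) x : 0 <= x ->
  psdmx (S0 - c%:C *: 1%:M) -> psdmx (Rm x - c%:C *: 1%:M).
Proof.
move=> x0 Sc; have xx : 0 <= (0 : R) <= x by rewrite lexx.
have -> : Rm x - c%:C *: 1%:M = (Rm x - Rm 0) + (S0 - c%:C *: 1%:M).
  by rewrite addrA Rmx0 subrK.
exact: psdmxD (Rmx_increasing xx) Sc.
Qed.

Lemma Rmx_pd x : 0 <= x -> pdmx (Rm x).
Proof.
move=> x0; have [c c0 Sc] := posdefmx_coercive adm.1.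
exact: pdmx_le (@scalemx1_pd R n c c0) (Rmx_coercive x0 Sc).
Qed.

Lemma invRmx_adj x : 0 <= x -> (invmx (Rm x))^t* = invmx (Rm x).
Proof. by move=> x0; rewrite adjV Rmx_adj. Qed.

Lemma invRmx_psd x : 0 <= x -> psdmx (invmx (Rm x)).
Proof.
move=> x0; have pdR := Rmx_pd x0.
exact: psdmx_inv (Rmx_adj x0) (pdmx_unit pdR) (pdmxW pdR).
Qed.

(** With X = e^(-ix alpha), Y = e^(ix alpha) and R = X S X^*, one has S^-1 = X^* R^-1 X. The factor
    X meets the Y next to theta2 and cancels it, and the two factors X^* on the left make up B^*. *)
Lemma pseudo_exp_potentialE x : 0 <= x ->
  pseudo_exp_potential alpha S0 theta1 theta2 x =
  2 *: ((B x)^t* *m invmx (Rm x) *m theta2).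
Proof.
move=> x0; have Ru := pdmx_unit (Rmx_pd x0); move: Ru.
rewrite /pseudo_exp_potential expmx_imul_adj expmx_imul /Bmx /flow /Rmx.
have := expmx_scaleN x%:C ('i%C *: alpha).
have := expmx_scaleNr x%:C ('i%C *: alpha).
move: (expmx (x%:C *: - ('i%C *: alpha))) (expmx (x%:C *: ('i%C *: alpha))).
move: (Smx alpha S0 theta1 theta2 x) => S X Y YX XY Ru.
rewrite -(sandwich_inv XY YX Ru) !adjM; congr (_ *: _).
by rewrite -!mulmxA (mulmxA X Y) XY mul1mx !mulmxA.
Qed.

Lemma tr_invRmx x : 0 <= x ->
  complex.Re (\tr ((B x)^t* *m invmx (Rm x) *m B x)) <= 2 * nrm alpha.
Proof.
move=> x0; have pdR := Rmx_pd x0; have Ru := pdmx_unit pdR.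
have B0 : 0 <= \tr ((B x)^t* *m invmx (Rm x) *m B x).
  exact/psdmx_tr_ge0/psdmx_congr_adj/invRmx_psd.
have T0 : 0 <= \tr (theta2^t* *m invmx (Rm x) *m theta2).
  exact/psdmx_tr_ge0/psdmx_congr_adj/invRmx_psd.
have trE : 'i%C * (\tr ((B x)^t* *m invmx (Rm x) *m B x) +
    \tr (theta2^t* *m invmx (Rm x) *m theta2)) = \tr alpha - Num.conj (\tr alpha).
  have tr_adj : \tr (alpha^t*) = Num.conj (\tr alpha).
    by rewrite trace_map_mx mxtrace_tr.
  rewrite -tr_adj.
  rewrite -[X in X - _](_ : \tr (alpha *m Rm x *m invmx (Rm x)) = _); last first.
    by rewrite -mulmxA mulmxV// mulmx1.
  rewrite -[X in _ = _ - X](_ : \tr (Rm x *m alpha^t* *m invmx (Rm x)) = _);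
      last first.
    by rewrite mxtrace_mulC mulmxA mulVmx// mul1mx.
  rewrite -raddfB -mulmxBl Rmx_lyapunov// -(scalemxAl 'i%C) [RHS]mxtraceZ
    mulmxDl mxtraceD.
  by congr (_ * (_ + _)); rewrite mxtrace_mulC mulmxA mxtrace_mulC mulmxA.
(* Taking imaginary parts turns the factor i into a real part; the theta2-trace is nonnegative and
   is dropped below. *)
have := congr1 (@complex.Im R) trE; rewrite mulrC ImiRe raddfD.
rewrite (_ : complex.Im (\tr alpha - _) = 2 * complex.Im (\tr alpha)); last first.
  by case: (\tr alpha) => a b /=; ring.
move=> E; apply: (@le_trans _ _ (2 * complex.Im (\tr alpha))).
  by rewrite -E lerDl ge0_Re_ge0.
rewrite ler_wpM2l// (le_trans (ler_norm _))// (le_trans (Im_le_normc _))//.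
exact: nrm_tr.
Qed.

(** By the trace identity this is 2 Im (tr alpha) - tr (B^* R^-1 B) for x >= 0. *)
Definition residual x := complex.Re (\tr (theta2^t* *m invmx (Rm x) *m theta2)).

Lemma residual_nonincreasing x y : 0 <= x <= y -> residual y <= residual x.
Proof.
move=> /andP[x0 xy]; have y0 := le_trans x0 xy.
rewrite -subr_ge0 -raddfB -raddfB -mulmxBl -mulmxBr.
apply/ge0_Re_ge0/psdmx_tr_ge0/psdmx_congr_adj.
have xy' : 0 <= x <= y by rewrite x0.
exact: psdmx_inv_antitone (Rmx_adj y0) (Rmx_adj x0) (Rmx_pd x0) (Rmx_increasing xy').
Qed.

(* The weighted AM-GM inequality for the form [R(x)^-1] bounds the entries of
   the potential by [tr (B^* R^-1 B)], which never exceeds [2 Im (tr alpha)],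
   and by [tr (theta2^* R^-1 theta2)], which is nonincreasing. *)
Lemma potential_tail (s M x : R) : 0 < s -> 0 <= M <= x ->
  nrm (pseudo_exp_potential alpha S0 theta1 theta2 x) <=
  (m1 * m2)%:R * (2 * (s * (2 * nrm alpha) + s^-1 * residual M)).
Proof.
move=> s0 /andP[M0 Mx]; have x0 := le_trans M0 Mx.
apply: nrm_le_entries => k l; rewrite pseudo_exp_potentialE// mxE Normc.normcM.
have -> : Normc.normc (2 : R[i]) = 2.
  by rewrite -(rmorph_nat (real_complex R)) normc_real ger0_norm.
rewrite ler_wpM2l//.
have W0 := invRmx_psd x0; rewrite mulmx_adj_entry.
apply: le_trans (psdmx_hform_amgm _ _ (invRmx_adj x0) W0 s0) _.
rewrite !hform_row_adj; apply: lerD; rewrite ler_wpM2l// ?invr_ge0 ?(ltW s0)//.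
  apply: le_trans (tr_invRmx x0); rewrite -subr_ge0 -raddfB ge0_Re_ge0// subr_ge0.
  exact/psdmx_diag_le_tr/psdmx_congr_adj.
apply: le_trans (residual_nonincreasing (x := M) (y := x) _); last by rewrite M0.
rewrite -subr_ge0 -raddfB ge0_Re_ge0// subr_ge0.
exact/psdmx_diag_le_tr/psdmx_congr_adj.
Qed.

End PotentialBounds.

(** * Growth of R(x) for controllable pairs *)

Section GrowthAlgebra.
Variable C : numClosedFieldType.

Lemma subrACA (V : zmodType) (x y z t : V) : x - y - (z - t) = x - z - (y - t).
Proof. by rewrite !opprD !opprK addrACA. Qed.

Lemma subr_step (V : zmodType) (a b e f : V) :
  a - (e + f) = (a - b - f) + (b - e).
Proof. by rewrite [a - b - f]addrAC addrA subrK opprD [- e - f]addrC addrA. Qed.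

Lemma sandwichZB n (E M N : 'M[C]_n) (c : C) :
  E *m (c *: (M - N)) *m E^t* = c *: (E *m M *m E^t*) - c *: (E *m N *m E^t*).
Proof. by rewrite -scalemxAr -scalemxAl mulmxBr mulmxBl scalerBr. Qed.

Lemma flow_sandwich_derivative n (E P A : 'M[C]_n) (c : C) :
  Num.conj c = - c -> E *m A = A *m E ->
  (c *: (A *m E) *m P) *m E^t* + E *m P *m (c *: (A *m E))^t* =
  E *m (c *: (A *m P - P *m A^t*)) *m E^t*.
Proof.
move=> cc EA.
have -> : E *m (c *: (A *m P - P *m A^t*)) *m E^t* =
    c *: (E *m A *m P *m E^t*) - c *: (E *m P *m A^t* *m E^t*).
  by rewrite -scalemxAr -scalemxAl mulmxBr mulmxBl scalerBr !mulmxA.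
rewrite adjZ cc -EA adjM scaleNr mulmxN -!scalemxAl -scalemxAr.
by rewrite !mulmxA.
Qed.

(** If P >= c, S <= r and E S E^* >= S, all terms on the right are positive semidefinite, so E P E^*
    >= d S with d = c / r. *)
Lemma growth_split n (E P S : 'M[C]_n) (c d r : C) : d * r = c ->
  E *m P *m E^t* - d *: S =
  E *m (P - c *: 1%:M) *m E^t* +
  d *: (E *m (r *: 1%:M - S) *m E^t* + (E *m S *m E^t* - S)).
Proof.
move=> <-.
have sandB (M N : 'M[C]_n) :
    E *m (M - N) *m E^t* = E *m M *m E^t* - E *m N *m E^t*.
  by rewrite mulmxBr mulmxBl.
have sand1 t : E *m (t *: 1%:M) *m E^t* = t *: (E *m E^t*).
  by rewrite -scalemxAr mulmx1 -scalemxAl.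
rewrite !sandB !sand1.
by apply/matrixP => k l; rewrite !mxE; ring.
Qed.

End GrowthAlgebra.

Section Growth.
Variables (R : realType) (n m1 m2 : nat).
Variables (alpha S0 : 'M[R[i]]_n).
Variables (theta1 : 'M[R[i]]_(n, m1)) (theta2 : 'M[R[i]]_(n, m2)).
Hypothesis adm : admissible alpha S0 theta1 theta2.

Local Notation B := (Bmx alpha theta1).
Local Notation Rm := (Rmx alpha S0 theta1 theta2).

Lemma controllable_annihilator (g : 'rV[R[i]]_n) : controllable alpha theta1 ->
  (forall k, g *m (alpha ^+ k *m theta1) = 0) -> g = 0.
Proof.
move=> ctrl g0; apply: trmx_inj; rewrite trmx0.
have : (1%:M <= kermx (g^T))%MS.
  apply: submx_trans (submx_full _ ctrl) _; apply/sumsmx_subP => k _.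
  by rewrite genmxE; apply/sub_kermxP; rewrite -trmx_mul g0 trmx0.
by move/sub_kermxP; rewrite mul1mx.
Qed.

(** If f is isotropic for R(1) - R(0), monotonicity makes the form of R(x) at f constant on [0, 1].
    Its derivative is twice the squared norm of f B(x), so f B vanishes on the open interval;
    differentiating repeatedly gives f alpha^k B = 0 for all k, which contradicts
    controllability. *)
Lemma Rmx_step_pd : controllable alpha theta1 -> pdmx (Rm 1 - Rm 0).
Proof.
move=> ctrl f f0.
have incr x y : 0 <= x <= y -> psdmx (Rm y - Rm x) by apply: Rmx_increasing adm _ _.
rewrite lt0r (incr 0 1) ?lexx ?ler01// andbT; apply: contra f0 => /eqP f01.
have [G [GE G0 Gd _]] := Rmx_flow adm.2.
have fR x : 0 <= x <= 1 -> hform (Rm x) f = hform (Rm 0) f.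
  move=> /andP[x0 x1]; apply/eqP; rewrite -subr_eq0 -hformB; apply/eqP/le_anti.
  rewrite incr ?lexx// andbT -f01 -subr_ge0 -hformB opprB addrA subrK.
  by apply: incr; rewrite x0.
have fB0 x : 0 < x < 1 -> f *m B x = 0.
  move=> /andP[x0 x1]; apply/eqP/contraT => /(@pdmx1 R[i] _ _).
  have h0 : cder (fun t => hform (G t) f) x 0.
    apply: (@cder_near _ (fun _ => hform (Rm 0) f) _ 0 1); first by rewrite x0.
      move=> t /andP[t0 t1]; have t01 : 0 <= t <= 1 by rewrite (ltW t0) (ltW t1).
      by rewrite -(GE t (ltW t0)); exact (esym (fR t t01)).
    exact: cder_cst.
  have := cder_unique h0 (cder_hform f (Gd x (ltW x0))) => /esym/eqP.
  rewrite hformZ mulf_eq0 pnatr_eq0 /= -[X in hform (X *m _)]mulmx1.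
  by rewrite hform_congr => /eqP ->; rewrite ltxx.
have fkB k x : 0 < x < 1 -> f *m alpha ^+ k *m B x = 0.
  elim: k x => [|k IH] x x01; first by rewrite expr0 [f *m _]mulmx1 fB0.
  have h0 : mder (fun t => f *m alpha ^+ k *m B t) x 0.
    apply: (@mder_near _ _ _ (fun _ => 0) _ 0 1) => //; last exact: mder_cst.
    by move=> t t01; rewrite IH.
  have h1 := mderMl (f *m alpha ^+ k) (Bmx_mder alpha theta1 x).
  have := mder_unique h0 h1; rewrite -scalemxAr => /esym/eqP.
  rewrite scaler_eq0 mulf_eq0 oppr_eq0 pnatr_eq0 /= => /orP[/eqP[]/eqP|/eqP].
    by rewrite oner_eq0.
  have -> : alpha ^+ k.+1 = alpha ^+ k *m alpha by rewrite exprSr.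
  by rewrite !mulmxA.
(* Any interior point would do. The flow there commutes with alpha, so f times the flow annihilates
   all alpha^k theta1, and the flow is invertible. *)
have h01 : 0 < (2^-1 : R) < 1 by rewrite invr_gt0 ltr0n/= invf_lt1 ?ltr1n.
have g0 : f *m flow alpha 2^-1 = 0.
  apply: controllable_annihilator => // k.
  have comm : alpha ^+ k *m (flow alpha 2^-1 *m theta1) =
            flow alpha 2^-1 *m (alpha ^+ k *m theta1).
    have := flow_commute alpha 2^-1; move: (flow alpha 2^-1) => E Ea.
    rewrite mulmxA [RHS]mulmxA; congr (_ *m _); elim: k => [|k IH].
      by rewrite expr0 [LHS]mul1mx [RHS]mulmx1.
    have -> : alpha ^+ k.+1 = alpha *m alpha ^+ k by rewrite exprS.
    by rewrite mulmxA Ea -!mulmxA IH.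
  rewrite -(mulmxA f) -comm (mulmxA f); exact: (fkB k _ h01).
by apply/eqP; rewrite -(mulmxK (flow_unit alpha 2^-1) f) g0 mul0mx.
Qed.

Lemma flow_sandwich_mder (P : 'M[R[i]]_n) x :
  mder (fun t => flow alpha t *m P *m (flow alpha t)^t*) x
    (flow alpha x *m ((- 2 * 'i%C) *: (alpha *m P - P *m alpha^t*))
     *m (flow alpha x)^t*).
Proof.
have h := mderM (mderMr P (flow_mder alpha x)) (mder_adj (flow_mder alpha x)).
apply: mder_eq h _; apply: flow_sandwich_derivative; last exact: flow_commute.
by apply/eqP; rewrite eq_complex /=; apply/andP; split; apply/eqP; ring.
Qed.

Lemma scale_N2i_i (M : 'M[R[i]]_n) : (- 2 * 'i%C) *: ('i%C *: M) = 2 *: M.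
Proof. by rewrite scalerA -mulrA -expr2 sqr_i mulrNN mulr1. Qed.

(** By admissibility the derivative of E S0 E^* is twice a congruence by E of theta1 theta1^* +
    theta2 theta2^*. *)
Lemma flow_sandwich_increasing x : 0 <= x ->
  psdmx (flow alpha x *m S0 *m (flow alpha x)^t* - S0).
Proof.
move=> x0.
have := psdmx_increment x0 (fun t _ => flow_sandwich_mder S0 t) _.
rewrite flow0 adj1 mul1mx mulmx1; apply => t _.
rewrite adm.2 scale_N2i_i; apply/psdmx_congr/psdmxZ; first exact: ler0n.
by apply: psdmxD; apply: psdmx_gram.
Qed.

(** Both sides vary at the same rate in x because B(t + s) = E(t) B(s), and they agree at 0. *)
Lemma Rmx_shift x : 0 <= x ->
  Rm (x + 1) - Rm x = flow alpha x *m (Rm 1 - Rm 0) *m (flow alpha x)^t*.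
Proof.
move=> x0; have [G [GE G0 Gd Ga]] := Rmx_flow adm.2.
rewrite !GE// ?addr_ge0//.
pose K t := (G (t + 1) - G t) - flow alpha t *m (G 1 - G 0) *m (flow alpha t)^t*.
(* The term theta2 theta2^* is the same at times 1 and 0 and drops out of the difference. *)
have P1 : alpha *m (G 1 - G 0) - (G 1 - G 0) *m alpha^t* =
    'i%C *: (B 1 *m (B 1)^t* - B 0 *m (B 0)^t*).
  rewrite mulmxBr mulmxBl subrACA (Ga 1 ler01) (Ga 0 (lexx 0)) -scalerBr.
  by rewrite opprD addrACA [X in _ *: (_ + X) = _]subrr addr0.
have Kd t : 0 <= t <= x -> mder K t 0.
  move=> /andP[t0 _].
  have h := mderB (mderB (mder_shift (Gd (t + 1) (addr_ge0 t0 ler01))) (Gd t t0))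
    (flow_sandwich_mder (G 1 - G 0) t).
  apply: mder_eq h _; rewrite P1 scale_N2i_i.
  have BB s : flow alpha t *m (B s *m (B s)^t*) *m (flow alpha t)^t* =
      B (t + s) *m (B (t + s))^t*.
    have -> : B (t + s) = flow alpha t *m B s by rewrite /Bmx flowD// mulmxA.
    exact: sandwich_gram.
  move: (BB 1) (BB 0); rewrite addr0.
  move: (B (t + 1)) (B t) (B 1) (B 0) (flow alpha t) => b' b b1 b0 E E1 E0.
  by rewrite sandwichZB E1 E0; apply: subrr.
have /eqP := mder0_constant x0 Kd.
rewrite {2}/K add0r flow0 adj1 mul1mx mulmx1 subrr subr_eq0.
by move=> /eqP.
Qed.

Lemma residual_vanishes (eta : R) : controllable alpha theta1 -> 0 < eta ->
  exists2 M : R, 0 <= M & residual alpha S0 theta1 theta2 M <= eta.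
Proof.
move=> ctrl eta0.
have S0h := posdefmx_adj adm.1.
have [c0 c0_gt0 S0c] := posdefmx_coercive adm.1.
have P0 := Rmx_step_pd ctrl.
have Ph : (Rm 1 - Rm 0)^t* = Rm 1 - Rm 0.
  exact: adjB_id (Rmx_adj adm ler01) (Rmx_adj adm (lexx 0)).
have [c c_gt0 Pc] := pdmx_coercive Ph P0.
(* The summand 1 makes r positive, so that c can be divided by it, even when n = 0. *)
pose r := nrm S0 + 1; have r0 : 0 < r by rewrite ltr_wpDl// nrm_ge0.
have S0r : psdmx (r%:C *: 1%:M - S0).
  have -> : r%:C *: 1%:M - S0 = ((nrm S0)%:C *: 1%:M - S0) + 1%:M.
    by rewrite /r rmorphD rmorph1 scalerDl scale1r addrAC.
  exact: psdmxD (psdmx_le_nrm S0h) (@psdmx1 _ n).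
pose d := c / r; have d0 : 0 < d by rewrite divr_gt0.
have step x : 0 <= x -> psdmx (Rm (x + 1) - Rm x - (d * c0)%:C *: 1%:M).
  move=> x0; have -> : Rm (x + 1) - Rm x - (d * c0)%:C *: 1%:M =
      (Rm (x + 1) - Rm x - d%:C *: S0) + d%:C *: (S0 - c0%:C *: 1%:M).
    by rewrite scalerBr scalerA -rmorphM addrA subrK.
  have dC : 0 <= d%:C by rewrite lecR ltW.
  apply: psdmxD; last exact: psdmxZ dC S0c.
  have dr : d%:C * r%:C = c%:C by rewrite -rmorphM divfK// gt_eqF.
  rewrite (Rmx_shift x0) (growth_split _ _ _ dr).
  apply: psdmxD; first exact: (psdmx_congr _ Pc).
  apply: (psdmxZ dC); apply: psdmxD; first exact: (psdmx_congr _ S0r).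
  exact: flow_sandwich_increasing.
have grow k : psdmx (Rm k%:R - (k%:R * (d * c0))%:C *: 1%:M).
  elim: k => [|k IH].
    rewrite mul0r scale0r subr0 (Rmx0 adm).
    exact: pdmxW (pdmx_le (@scalemx1_pd _ n _ c0_gt0) S0c).
  have -> : Rm k.+1%:R - (k.+1%:R * (d * c0))%:C *: 1%:M =
      (Rm (k%:R + 1) - Rm k%:R - (d * c0)%:C *: 1%:M) +
      (Rm k%:R - (k%:R * (d * c0))%:C *: 1%:M).
    by rewrite -natr1 mulrDl mul1r rmorphD scalerDl -subr_step.
  exact: psdmxD (step _ (ler0n _ _)) IH.
pose T := complex.Re (\tr (theta2^t* *m theta2)).
have trT : 0 <= \tr (theta2^t* *m theta2).
  by apply: psdmx_tr_ge0; rewrite -{2}[theta2]trmxCK; apply: psdmx_gram.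
have T0 : 0 <= T by apply: ge0_Re_ge0.
pose e := d * c0; have e0 : 0 < e by rewrite mulr_gt0.
(* From R(k) >= k e follows R(k)^-1 <= 1 / (k e), so the trace is at most T / (k e); k is taken
   large enough for this to be at most eta, and the successor makes it positive. *)
pose k := (Num.bound (T / (e * eta))).+1.
exists k%:R => //; have k0 : 0 < k%:R * e by rewrite mulr_gt0// ltr0n.
have := psdmx_inv_antitone (Rmx_adj adm (ler0n _ k)) (@scalemx1_adj _ n (k%:R * e))
  (@scalemx1_pd _ n _ k0) (grow k).
rewrite invmx_scale1// => /(psdmx_congr_adj theta2)/psdmx_tr_ge0/ge0_Re_ge0.
rewrite mulmxBr mulmxBl !raddfB /= subr_ge0 => /le_trans; apply.
rewrite -scalemxAr mulmx1 -scalemxAl mxtraceZ.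
have -> : \tr (theta2^t* *m theta2) = T%:C by apply: ge0_ReE trT.
rewrite -rmorphM /= ler_pdivrMl// -mulrA -(ler_pdivrMr _ _ (mulr_gt0 e0 eta0)).
apply/ltW/(lt_le_trans (archi_boundP _)); first by rewrite divr_ge0// mulr_ge0// ltW.
by rewrite ler_nat leqnSn.
Qed.

End Growth.

(** * Uniform convergence on compact intervals *)

Section UniformConvergence.
Variables (R : realType) (I : Type) (F : set_system I) (D : set R).
Context {FF : Filter F}.

(** A bound on the limit is part of the notion because products are not uniformly continuous on
    unbounded sets. *)
Definition ucvg m n (f : I -> R -> 'M[R[i]]_(m, n)) (f0 : R -> 'M[R[i]]_(m, n)) :
  Prop :=
  (exists2 K : R, 0 <= K & forall x, D x -> nrm (f0 x) <= K) /\
  (forall e : R, 0 < e -> \forall q \near F,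
     forall x, D x -> nrm (f q x - f0 x) <= e).

Lemma ucvg_cst m n (A : I -> 'M[R[i]]_(m, n)) A0 :
  (forall e : R, 0 < e -> \forall q \near F, nrm (A q - A0) <= e) ->
  ucvg (fun q _ => A q) (fun _ => A0).
Proof.
move=> AA0; split; first by exists (nrm A0); rewrite ?nrm_ge0.
by move=> e /AA0; apply: filterS.
Qed.

Lemma ucvgM m n p (f : I -> R -> 'M[R[i]]_(m, n)) f0
    (g : I -> R -> 'M[R[i]]_(n, p)) g0 :
  ucvg f f0 -> ucvg g g0 ->
  ucvg (fun q x => f q x *m g q x) (fun x => f0 x *m g0 x).
Proof.
move=> [[K K0 f0K] ff0] [[L L0 g0L] gg0]; split.
  exists (K * L); first exact: mulr_ge0.
  by move=> x Dx; rewrite (le_trans (nrmM _ _))// ler_pM ?nrm_ge0 ?f0K ?g0L.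
(* With both factors within t of their limits, the three terms of [split_mul] add up to at most t (t
   + L + K); the minimum with 1 absorbs the quadratic term. *)
move=> e e0; pose t := Num.min 1 (e / (1 + L + K)).
have LK : 0 < 1 + L + K by rewrite -addrA ltr_pwDl// addr_ge0.
have t0 : 0 < t by rewrite lt_min ltr01 divr_gt0.
have te : t * (1 + L + K) <= e by rewrite -ler_pdivlMr// ge_min lexx orbT.
apply: filterS2 (ff0 t t0) (gg0 t t0) => q fq gq x Dx.
have split_mul (a a0 : 'M[R[i]]_(m, n)) (b b0 : 'M[R[i]]_(n, p)) :
    a *m b - a0 *m b0 = (a - a0) *m (b - b0) + (a - a0) *m b0 + a0 *m (b - b0).
  by rewrite -mulmxDr subrK mulmxBl mulmxBr addrA subrK.
rewrite split_mul (le_trans _ te)// 2!mulrDr mulr1.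
rewrite (le_trans (nrmD _ _))// lerD//.
  rewrite (le_trans (nrmD _ _))// lerD//; rewrite (le_trans (nrmM _ _))//.
    rewrite -[leRHS]mulr1 ler_pM ?nrm_ge0 ?fq// (le_trans (gq x Dx))//.
    by rewrite ge_min lexx.
  by rewrite ler_pM ?nrm_ge0 ?fq ?g0L.
by rewrite (le_trans (nrmM _ _))// mulrC ler_pM ?nrm_ge0 ?gq ?f0K.
Qed.

Lemma ucvg_adj m n (f : I -> R -> 'M[R[i]]_(m, n)) f0 : ucvg f f0 ->
  ucvg (fun q x => (f q x)^t*) (fun x => (f0 x)^t*).
Proof.
move=> [[K K0 f0K] ff0]; split.
  by exists K => // x Dx; rewrite nrm_adj f0K.
move=> e /ff0; apply: filterS => q fq x Dx.
by rewrite -adjB nrm_adj fq.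
Qed.

Lemma ucvgZ m n (c : R[i]) (f : I -> R -> 'M[R[i]]_(m, n)) f0 : ucvg f f0 ->
  ucvg (fun q x => c *: f q x) (fun x => c *: f0 x).
Proof.
move=> [[K K0 f0K] ff0]; split.
  exists (Normc.normc c * K); first by rewrite mulr_ge0 ?normc_ge0.
  by move=> x Dx; rewrite nrmZ ler_wpM2l ?normc_ge0 ?f0K.
move=> e e0; have c1 : 0 < Normc.normc c + 1 by rewrite ltr_wpDl ?normc_ge0.
apply: filterS (ff0 (e / (Normc.normc c + 1)) (divr_gt0 e0 c1)) => q fq x Dx.
rewrite -scalerBr nrmZ.
apply: (@le_trans _ _ ((Normc.normc c + 1) * nrm (f q x - f0 x))).
  by rewrite ler_wpM2r ?nrm_ge0// lerDl.
by rewrite mulrC -ler_pdivlMr// fq.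
Qed.

(** The resolvent identity a^-1 - b^-1 = a^-1 (b - a) b^-1 applies, and the common lower bound c
    bounds both inverses by the same K. *)
Lemma ucvg_invmx n (f : I -> R -> 'M[R[i]]_n) f0 (c : R) : 0 < c ->
  (forall x, D x -> (f0 x)^t* = f0 x /\ psdmx (f0 x - c%:C *: 1%:M)) ->
  (\forall q \near F, forall x, D x ->
     (f q x)^t* = f q x /\ psdmx (f q x - c%:C *: 1%:M)) ->
  ucvg f f0 -> ucvg (fun q x => invmx (f q x)) (fun x => invmx (f0 x)).
Proof.
move=> c0 f0c fc [_ ff0]; pose K : R := (n * n)%:R * (2 * c^-1).
have K0 : 0 <= K by rewrite !mulr_ge0// invr_ge0 ltW.
split.
  by exists K => // x /f0c[h1 h2]; have [_] := nrm_invmx_coercive c0 h1 h2.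
move=> e e0; have K1 : 0 < K * K + 1 by rewrite ltr_wpDl// mulr_ge0.
apply: filterS2 fc (ff0 (e / (K * K + 1)) (divr_gt0 e0 K1)) => q fqc fq x Dx.
have [h1 h2] := f0c x Dx; have [h3 h4] := fqc x Dx.
have [u1 b1] := nrm_invmx_coercive c0 h1 h2.
have [u2 b2] := nrm_invmx_coercive c0 h3 h4.
have -> : invmx (f q x) - invmx (f0 x) =
    invmx (f q x) *m (f0 x - f q x) *m invmx (f0 x).
  by rewrite mulmxBr mulmxBl mulVmx// mul1mx -mulmxA mulmxV// mulmx1.
apply: le_trans (nrmM _ _) _.
apply: (@le_trans _ _ (K * nrm (f q x - f0 x) * K)).
  rewrite ler_pM ?nrm_ge0//; apply: le_trans (nrmM _ _) _.
  by rewrite nrmB ler_wpM2r ?nrm_ge0.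
rewrite mulrAC; apply: (@le_trans _ _ ((K * K + 1) * nrm (f q x - f0 x))).
  by rewrite ler_wpM2r ?nrm_ge0// lerDl.
by rewrite mulrC -ler_pdivlMr// fq.
Qed.

End UniformConvergence.

(** * Convergence of the potentials on [0, M] *)

Section PotentialConvergence.
Variables (R : realType) (I : Type) (F : set_system I) (n m1 m2 : nat).
Context {FF : Filter F}.
Variables (al S : I -> 'M[R[i]]_n).
Variables (th1 : I -> 'M[R[i]]_(n, m1)) (th2 : I -> 'M[R[i]]_(n, m2)).
Variables (alpha S0 : 'M[R[i]]_n).
Variables (theta1 : 'M[R[i]]_(n, m1)) (theta2 : 'M[R[i]]_(n, m2)).
Hypothesis adm : admissible alpha S0 theta1 theta2.
Hypothesis admF : \forall q \near F, admissible (al q) (S q) (th1 q) (th2 q).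
Hypothesis cv_al : forall e : R, 0 < e ->
  \forall q \near F, nrm (al q - alpha) <= e.
Hypothesis cv_S : forall e : R, 0 < e ->
  \forall q \near F, nrm (S q - S0) <= e.
Hypothesis cv_th1 : forall e : R, 0 < e ->
  \forall q \near F, nrm (th1 q - theta1) <= e.
Hypothesis cv_th2 : forall e : R, 0 < e ->
  \forall q \near F, nrm (th2 q - theta2) <= e.
Variable M : R.
Hypothesis M0 : 0 <= M.

Let D : set R := [set x | 0 <= x <= M].

Lemma ucvg_expmx (A : I -> 'M[R[i]]_n) A0 :
  (forall e : R, 0 < e -> \forall q \near F, nrm (A q - A0) <= e) ->
  ucvg F D (fun q x => expmx (x%:C *: A q)) (fun x => expmx (x%:C *: A0)).
Proof.
move=> AA0; have [L L0 Lip] := expmx_perturbation n (nrm A0 + 1) M0.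
split.
  exists ((n * n)%:R * (2 * expR (M * nrm A0))).
    by rewrite !mulr_ge0 ?expR_ge0.
  move=> x /andP[x0 xM]; apply: le_trans (nrm_expmx_le _) _.
  rewrite ler_wpM2l// ler_wpM2l// ler_expR nrmZ normc_real ger0_norm//.
  by rewrite ler_wpM2r ?nrm_ge0.
move=> e e0; have L1 : 0 < L + 1 by rewrite ltr_wpDl.
apply: filterS2 (AA0 1 ltr01) (AA0 (e / (L + 1)) (divr_gt0 e0 L1)) => q q1 qe x Dx.
have qK : nrm (A q) <= nrm A0 + 1.
  by rewrite -[A q](subrK A0) addrC (le_trans (nrmD _ _))// lerD2l.
apply: le_trans (Lip _ _ x qK _ Dx) _; first by rewrite lerDl.
apply: (@le_trans _ _ ((L + 1) * nrm (A q - A0))).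
  by rewrite ler_wpM2r ?nrm_ge0// lerDl.
by rewrite mulrC -ler_pdivlMr.
Qed.

Lemma ucvg_Bmx :
  ucvg F D (fun q x => Bmx (al q) (th1 q) x) (fun x => Bmx alpha theta1 x).
Proof.
have cvA (e : R) : 0 < e ->
    \forall q \near F, nrm (- ('i%C *: al q) - - ('i%C *: alpha)) <= e.
  move=> /cv_al; apply: filterS => q.
  have -> : - ('i%C *: al q) - - ('i%C *: alpha) = - 'i%C *: (al q - alpha).
    by rewrite scaleNr scalerBr opprD.
  by rewrite nrmZ normcB normc_i mul1r.
have cvE := ucvg_expmx cvA.
exact: ucvgM (ucvgM cvE cvE) (ucvg_cst _ cv_th1).
Qed.

(** The derivatives 2 B B^* converge uniformly on [0, M] and the initial values S converge to S0;
    the mean value bound gives convergence of R. *)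
Lemma ucvg_Rmx : ucvg F D (fun q x => Rmx (al q) (S q) (th1 q) (th2 q) x)
                          (fun x => Rmx alpha S0 theta1 theta2 x).
Proof.
have cvD := ucvgZ 2 (ucvgM ucvg_Bmx (ucvg_adj ucvg_Bmx)).
have [[K K0 DK] cvDe] := cvD.
have [G0 [G0E G00 G0d _]] := Rmx_flow adm.2.
split.
  exists ((n * n)%:R * (2 * K * M) + nrm S0).
    by rewrite addr_ge0 ?nrm_ge0// !mulr_ge0.
  move=> x /andP[x0 xM]; rewrite G0E// -[G0 x](subrK (G0 0)).
  apply: le_trans (nrmD _ _) _; rewrite {2}G00 lerD2r.
  apply: le_trans (mder_bound x0 (fun t (h : 0 <= t <= x) => G0d t _) _) _.
  - by move=> t /andP[].
  - by move=> t /andP[t0 tx]; apply: DK; rewrite /D/= t0 (le_trans tx).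
  by rewrite subr0 !ler_wpM2l// mulr_ge0.
(* The first summand of C is the mean value factor for the error of the derivative, the summand 1
   accounts for the error of the initial value. *)
move=> e e0; pose C : R := (n * n)%:R * (2 * M) + 1.
have C0 : 0 < C by rewrite ltr_wpDl// !mulr_ge0.
have eC : 0 < e / C by rewrite divr_gt0.
apply: filterS3 admF (cvDe _ eC) (cv_S eC) => q admq qD qS x /andP[x0 xM].
have [G [GE G0' Gd _]] := Rmx_flow admq.2.
rewrite G0E// GE//.
have -> : G x - G0 x = (G x - G0 x - (G 0 - G0 0)) + (S q - S0).
  by rewrite G0' G00 subrK.
apply: le_trans (nrmD _ _) _.
have GG0d t : 0 <= t <= x -> mder (fun t => G t - G0 t) t
    (2 *: (Bmx (al q) (th1 q) t *m (Bmx (al q) (th1 q) t)^t*) -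
     2 *: (Bmx alpha theta1 t *m (Bmx alpha theta1 t)^t*)).
  by move=> /andP[t0 _]; exact: mderB (Gd t t0) (G0d t t0).
have qDx t : 0 <= t <= x ->
    nrm (2 *: (Bmx (al q) (th1 q) t *m (Bmx (al q) (th1 q) t)^t*) -
     2 *: (Bmx alpha theta1 t *m (Bmx alpha theta1 t)^t*)) <= e / C.
  by move=> /andP[t0 tx]; apply: qD; rewrite /D/= t0 (le_trans tx).
apply: le_trans (lerD (mder_bound x0 GG0d qDx) qS) _.
have Ce : e = C * (e / C) by rewrite mulrC divfK// gt_eqF.
rewrite [leRHS]Ce subr0 [leRHS]mulrDl mul1r lerD2r -[leRHS]mulrA ler_wpM2l//.
by rewrite mulrAC ler_wpM2r// ?ler_wpM2l// ltW.
Qed.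

Lemma ucvg_invRmx :
  ucvg F D (fun q x => invmx (Rmx (al q) (S q) (th1 q) (th2 q) x))
           (fun x => invmx (Rmx alpha S0 theta1 theta2 x)).
Proof.
have [c c0 Sc] := posdefmx_coercive adm.1.
(* Matrices S within c / 2 of S0 keep the lower bound c - c / 2. *)
have c2 : 0 < c / 2 by rewrite divr_gt0.
apply: (ucvg_invmx c2 _ _ ucvg_Rmx).
  move=> x /andP[x0 _]; split; first exact (Rmx_adj adm x0).
  apply (Rmx_coercive adm x0).
  have -> : c / 2 = c - c / 2 by rewrite {2}(splitr c) addrK.
  apply: coercive_perturbation Sc; try exact: posdefmx_adj adm.1.
  by rewrite subrr nrm0 ltW.
apply: filterS2 admF (cv_S c2) => q admq qS x /andP[x0 _].
split; first exact (Rmx_adj admq x0).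
apply (Rmx_coercive admq x0).
have -> : c / 2 = c - c / 2 by rewrite {2}(splitr c) addrK.
exact: coercive_perturbation (posdefmx_adj adm.1) (posdefmx_adj admq.1) qS Sc.
Qed.

Lemma ucvg_potential (e : R) : 0 < e -> \forall q \near F, forall x, D x ->
  nrm (pseudo_exp_potential (al q) (S q) (th1 q) (th2 q) x -
       pseudo_exp_potential alpha S0 theta1 theta2 x) <= e.
Proof.
have [_ cv] :=
  ucvgZ 2 (ucvgM (ucvgM (ucvg_adj ucvg_Bmx) ucvg_invRmx) (ucvg_cst D cv_th2)).
move=> /cv; apply: filterS2 admF => q admq qe x Dx.
have /andP[x0 _] := Dx.
by rewrite (pseudo_exp_potentialE adm x0) (pseudo_exp_potentialE admq x0) qe.
Qed.

Lemma cvg_residual (e : R) : 0 < e -> \forall q \near F,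
  residual (al q) (S q) (th1 q) (th2 q) M <= residual alpha S0 theta1 theta2 M + e.
Proof.
have cvt : ucvg F D (fun q _ => th2 q) (fun _ => theta2) by apply: ucvg_cst.
have [_ cv] := ucvgM (ucvgM (ucvg_adj cvt) ucvg_invRmx) cvt.
move=> /cv; apply: filterS => q qe.
have DM : D M by rewrite /D/= M0 lexx.
rewrite -lerBlDl -raddfB -raddfB /= (le_trans (ler_norm _))//.
rewrite (le_trans (Re_le_normc _))// (le_trans (nrm_tr _))//.
exact: (qe M DM).
Qed.

End PotentialConvergence.

(** * The neighborhood of the potential *)

Section Neighborhoods.
Variables (R : realType) (n m1 m2 : nat).
Variables (alpha S0 : 'M[R[i]]_n).
Variables (theta1 : 'M[R[i]]_(n, m1)) (theta2 : 'M[R[i]]_(n, m2)).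

Definition quadruple : Type :=
  ('M[R[i]]_n * 'M[R[i]]_n * 'M[R[i]]_(n, m1) * 'M[R[i]]_(n, m2))%type.

(** Turns the choice of delta into a [near] statement, so that finitely many smallness conditions
    combine freely. Admissibility is built in, as perturbations range over admissible quadruples
    only. *)
Definition quadruple_nbhs : set_system quadruple :=
  filter_from [set d : R | 0 < d] (fun d => [set q : quadruple |
    admissible q.1.1.1 q.1.1.2 q.1.2 q.2 /\
    opnorm (alpha - q.1.1.1) + opnorm (S0 - q.1.1.2) + opnorm (theta1 - q.1.2)
      + opnorm (theta2 - q.2) < d]).

#[local] Instance quadruple_nbhs_filter : Filter quadruple_nbhs.
Proof.
apply: filter_from_filter; first by exists 1; apply: ltr01.
move=> d e /= d0 e0; exists (Num.min d e); first by rewrite /= lt_min d0.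
by move=> q /= [admq]; rewrite lt_min => /andP[qd qe].
Qed.

Lemma quadruple_nbhs_opnorm p m (A : quadruple -> 'M[R[i]]_(p, m)) A0 :
  (forall q : quadruple, opnorm (A0 - A q) <=
     opnorm (alpha - q.1.1.1) + opnorm (S0 - q.1.1.2) + opnorm (theta1 - q.1.2)
      + opnorm (theta2 - q.2)) ->
  forall e : R, 0 < e -> \forall q \near quadruple_nbhs, nrm (A q - A0) <= e.
Proof.
move=> A0A e e0; have c0 : 0 < (p * m)%:R + 1 :> R by rewrite ltr_wpDl.
exists (e / ((p * m)%:R + 1)); first by rewrite /= divr_gt0.
move=> q /= [_ qd]; rewrite nrmB (le_trans (nrm_le_opnorm _))//.
apply: (@le_trans _ _ (((p * m)%:R + 1) * opnorm (A0 - A q))).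
  by rewrite ler_wpM2r ?opnorm_ge0// lerDl.
by rewrite mulrC -ler_pdivlMr// (le_trans (A0A q))// ltW.
Qed.

Hypothesis adm : admissible alpha S0 theta1 theta2.
Hypothesis ctrl : controllable alpha theta1.

Lemma potential_uniformly_close (eps : R) : 0 < eps ->
  \forall q \near quadruple_nbhs, forall x, 0 <= x ->
    nrm (pseudo_exp_potential q.1.1.1 q.1.1.2 q.1.2 q.2 x -
         pseudo_exp_potential alpha S0 theta1 theta2 x) <= eps.
Proof.
move=> eps0.
have admF : \forall q \near quadruple_nbhs, admissible q.1.1.1 q.1.1.2 q.1.2 q.2.
  by exists 1 => [|q []]; first exact: ltr01.
have cv_al : forall e : R, 0 < e ->
    \forall q \near quadruple_nbhs, nrm (q.1.1.1 - alpha) <= e.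
  apply: quadruple_nbhs_opnorm => q.
  by rewrite -!addrA lerDl !addr_ge0 ?opnorm_ge0.
have cv_S : forall e : R, 0 < e ->
    \forall q \near quadruple_nbhs, nrm (q.1.1.2 - S0) <= e.
  apply: quadruple_nbhs_opnorm => q.
  by rewrite [leRHS]addrAC -!addrA addrCA lerDl !addr_ge0 ?opnorm_ge0.
have cv_th1 : forall e : R, 0 < e ->
    \forall q \near quadruple_nbhs, nrm (q.1.2 - theta1) <= e.
  apply: quadruple_nbhs_opnorm => q.
  by rewrite [leRHS]addrAC lerDr !addr_ge0 ?opnorm_ge0.
have cv_th2 : forall e : R, 0 < e ->
    \forall q \near quadruple_nbhs, nrm (q.2 - theta2) <= e.
  by apply: quadruple_nbhs_opnorm => q; rewrite lerDr !addr_ge0 ?opnorm_ge0.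
(* The tail bound is at most 2 N (2 s C + s^-1 eta), where C also bounds the perturbed alpha. The
   choice of s makes the first term t / 2, that of eta makes the second t / 2, and 2 N t = eps /
   2. *)
pose N : R := (m1 * m2)%:R + 1; have N0 : 0 < N by rewrite ltr_wpDl.
pose C : R := nrm alpha + 1; have C0 : 0 < C by rewrite ltr_wpDl ?nrm_ge0.
pose t := eps / (4 * N); have t0 : 0 < t by rewrite divr_gt0// mulr_gt0.
pose s := t / (4 * C); have s0 : 0 < s by rewrite divr_gt0// mulr_gt0.
pose eta := s * t / 2; have eta0 : 0 < eta by rewrite divr_gt0// mulr_gt0.
(* Half of eta is spent on the unperturbed trace at M, the other half on its change under
   perturbation. *)
have eta2 : 0 < eta / 2 by rewrite divr_gt0.
have [M M0 resM] := residual_vanishes adm ctrl eta2.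
have tail a S (th1 : 'M[R[i]]_(n, m1)) (th2 : 'M[R[i]]_(n, m2)) x :
    admissible a S th1 th2 -> nrm a <= C -> residual a S th1 th2 M <= eta ->
    M <= x -> nrm (pseudo_exp_potential a S th1 th2 x) <= eps / 2.
  move=> admq aC resq Mx; have Mx' : 0 <= M <= x by rewrite M0.
  apply: le_trans (potential_tail admq s0 Mx') _.
  have h1 : s * (2 * nrm a) <= t / 2.
    apply: (@le_trans _ _ (s * (2 * C))).
      by rewrite ler_wpM2l ?(ltW s0)// ler_wpM2l.
    rewrite le_eqVlt; apply/orP; left; apply/eqP; rewrite /s.
    by field; rewrite gt_eqF.
  have h2 : s^-1 * residual a S th1 th2 M <= t / 2.
    apply: (@le_trans _ _ (s^-1 * eta)); first by rewrite ler_wpM2l// invr_ge0 ltW.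
    by rewrite /eta -mulrA mulKf// gt_eqF.
  apply: (@le_trans _ _ (N * (2 * t))); last first.
    rewrite le_eqVlt; apply/orP; left; apply/eqP; rewrite /t.
    by field; rewrite gt_eqF.
  apply: (@le_trans _ _ ((m1 * m2)%:R * (2 * t))).
    by rewrite ler_wpM2l// ler_wpM2l// [leRHS](splitr t) lerD.
  by rewrite ler_wpM2r ?lerDl// mulr_ge0// ltW.
have close := ucvg_potential (FF := quadruple_nbhs_filter) adm admF
  cv_al cv_S cv_th1 cv_th2 M0 eps0.
have cres := cvg_residual (FF := quadruple_nbhs_filter) adm admF
  cv_al cv_S cv_th1 cv_th2 M0 eta2.
near=> q => x x0.
have admq : admissible q.1.1.1 q.1.1.2 q.1.2 q.2 by near: q.
have qal : nrm (q.1.1.1 - alpha) <= 1 by near: q; apply: cv_al.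
have qres : residual q.1.1.1 q.1.1.2 q.1.2 q.2 M <=
  residual alpha S0 theta1 theta2 M + eta / 2 by near: q.
have qclose : forall x, 0 <= x <= M ->
  nrm (pseudo_exp_potential q.1.1.1 q.1.1.2 q.1.2 q.2 x -
       pseudo_exp_potential alpha S0 theta1 theta2 x) <= eps by near: q.
have [xM|/ltW Mx] := leP x M; first by apply: qclose; rewrite /= x0.
(* Beyond M the two potentials are not compared with each other: each is at most eps / 2. *)
apply: le_trans (nrmD _ _) _; rewrite nrmN [leRHS]splitr; apply: lerD.
  apply: tail => //.
    rewrite -[q.1.1.1](subrK alpha) addrC (le_trans (nrmD _ _))//.
    by rewrite lerD2l.
  by rewrite (le_trans qres)// [leRHS]splitr lerD2r.
apply: tail => //; first by rewrite lerDl.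
by rewrite (le_trans resM)// ler_pdivrMr// mulr_natr mulr2n lerDl ltW.
Unshelve. all: by end_near. Qed.

End Neighborhoods.

Unset Implicit Arguments.
Local Close Scope sesquilinear_scope.

Theorem theorem3p7 (R : realType) (n m1 m2 : nat) (alpha S0 : 'M[R[i]]_n)
    (theta1 : 'M[R[i]]_(n, m1)) (theta2 : 'M[R[i]]_(n, m2))
    (adm : admissible alpha S0 theta1 theta2)
    (ctrl : controllable alpha theta1) (eps : R) (eps_gt0 : 0 < eps) :
  exists2 delta : R, 0 < delta &
    forall (alpha' S0' : 'M[R[i]]_n) (theta1' : 'M[R[i]]_(n, m1))
           (theta2' : 'M[R[i]]_(n, m2)),
      admissible alpha' S0' theta1' theta2' ->
      opnorm (alpha - alpha') + opnorm (S0 - S0') + opnorm (theta1 - theta1')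
        + opnorm (theta2 - theta2') < delta ->
      (ereal_sup [set (opnorm (pseudo_exp_potential alpha S0 theta1 theta2 x
                        - pseudo_exp_potential alpha' S0' theta1' theta2' x)%R)%:E
                 | x in [set x : R | (0 <= x)%R]] < eps%:E)%E.
Proof.
(* A nonstrict pointwise bound passes to the supremum, so eps / 2 is used to obtain the strict
   inequality. *)
have eps2 : 0 < eps / 2 by rewrite divr_gt0.
have [delta delta0 close] := potential_uniformly_close adm ctrl eps2.
exists delta => // alpha' S0' theta1' theta2' adm' lt_delta.
apply: (@le_lt_trans _ _ (eps / 2)%:E); last first.
  by rewrite lte_fin ltr_pdivrMr// mulr_natr mulr2n ltrDl.
apply: ge_ereal_sup => _ [x /= x0 <-]; rewrite lee_fin.
apply: le_trans (opnorm_le_nrm _) _; rewrite nrmB.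
exact: (close (alpha', S0', theta1', theta2') (conj adm' lt_delta)).
Qed.
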